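(* Let $T$ be an automorphism of a standard probability Borel space $(X,\mathcal{B},\mu)$, $G$ a second countable locally compact Abelian group, $\varphi:X\to G$ a measurable map, $\mathcal{S}=(S_g)_{g\in G}$ a $G$-action on a standard probability Borel space $(Y,\mathcal{C},\nu)$, and $T_{\varphi,\mathcal{S}}(x,y)=(Tx,S_{\varphi(x)}(y))$ on $(X\times Y,\mathcal{B}\otimes\mathcal{C},\mu\otimes\nu)$. Assume that $T_{\varphi,\mathcal{S}}$ is ergodic. Then the relative Kronecker factor of $T_{\varphi,\mathcal{S}}$ over $T$ is equal to $\mathcal{B}\otimes\mathcal{K}(\mathcal{S})$.
   Context: An automorphism is an invertible measure-preserving transformation. A $G$-action is a measurable group homomorphism $g\mapsto S_g\in\mathrm{Aut}(Y,\mathcal{C},\nu)$. Sub-$\sigma$-algebras are understood modulo null sets. $\mathcal{K}(\mathcal{S})\subset\mathcal{C}$, the Kronecker factor of $\mathcal{S}$, is the $\sigma$-algebra generated by all eigenfunctions of $\mathcal{S}$, i.e. the $g\in L^2(Y,\mathcal{C},\nu)$, $g\ne0$, such that for some $\chi\in\widehat{G}$, $g\circ S_h=\chi(h)g$ for all $h\in G$. Relative Kronecker factor: let $R$ be an ergodic automorphism of a standard probability space $(Z,\mathcal{D},\eta)$ and $\mathcal{E}\subset\mathcal{D}$ an $R$-invariant sub-$\sigma$-algebra (factor), with quotient map $z\mapsto\bar z$, $Z\to Z/\mathcal{E}$. A relative eigenvalue is an $\mathcal{E}$-measurable map $c:Z/\mathcal{E}\to U(n)$ (for some $n\ge1$)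 for which there is a measurable $M=(M_1,\dots,M_n):Z\to\mathbb{C}^n$ with $c(\bar z)M(z)=M(Rz)$ (column vectors) for a.e. $z$, $E(M_i\overline{M_j}\,|\,\mathcal{E})=0$ for $i\ne j$, and $E(|M_i|^2\,|\,\mathcal{E})=1$ for all $i$; $M$ is then called a relative eigenfunction. The relative Kronecker factor of $R$ over $R|_{\mathcal{E}}$ is the smallest $\sigma$-algebra (containing $\mathcal{E}$) making all relative eigenfunctions measurable. Here $R=T_{\varphi,\mathcal{S}}$ and the factor $T$ corresponds to $\mathcal{E}=\mathcal{B}\otimes\{\emptyset,Y\}$. *)

(* Defs.v *)
From HB Require Import structures.
From mathcomp Require Import all_boot all_order all_algebra.
From mathcomp Require Import complex.
From mathcomp Require Import all_classical all_reals all_analysis.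

Set Implicit Arguments.
Unset Strict Implicit.
Unset Printing Implicit Defensive.

Import Order.TTheory GRing.Theory Num.Theory numFieldNormedType.Exports.
Local Open Scope classical_set_scope.
Local Open Scope ring_scope.

(* The sigma-algebra on the target is the Borel one, hence it is enough to test
   open sets when F is a sigma-algebra. The topology on complex numbers is the
   norm topology carried by R[i]^o. *)
Definition measurable_wrt (Z : Type) (U : topologicalType) (F : set (set Z))
    (f : Z -> U) : Prop :=
  forall O : set U, open O -> F (f @^-1` O).

(* Borel isomorphic to a Polish space, i.e. to a second countable Hausdorff
   space whose topology comes from a complete metric. *)
Definition standard_borel (R : realType) (d : measure_display)
    (X : measurableType d) : Prop :=
  exists (P : completePseudoMetricType R) (f : X -> P),
    [/\ hausdorff_space P, @second_countable P, bijective f &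
        @measurable d X = preimage_set_system setT f <<s @open P >>].

(* Automorphisms are identified when they agree almost everywhere, so
   invertibility is asked for up to null sets. *)
Definition automorphism (R : realType) (d : measure_display)
    (X : measurableType d) (mu : probability X R) (T : X -> X) : Prop :=
  [/\ measurable_fun setT T,
      forall A, measurable A -> mu (T @^-1` A) = mu A &
      exists T' : X -> X,
        [/\ measurable_fun setT T', {ae mu, forall x, T' (T x) = x} &
            {ae mu, forall x, T (T' x) = x}]].

Definition ergodic (R : realType) (d : measure_display)
    (X : measurableType d) (mu : probability X R) (T : X -> X) : Prop :=
  forall A, measurable A -> mu ((T @^-1` A) `+` A) = 0%E ->
    mu A = 0%E \/ mu A = 1%E.

Definition product_salgebra (X Y : Type) (F : set (set X)) (H : set (set Y)) :
    set (set (X * Y)) :=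
  <<s [set A `*` B | A in F & B in H] >>.

(* A measurable homomorphism from G to the automorphism group of nu, given by a
   jointly measurable representative (g, y) |-> S g y; as equality of
   automorphisms is almost everywhere equality, so is the homomorphism law. *)
Definition measurable_action (R : realType) (G : topologicalZmodType)
    (d : measure_display) (Y : measurableType d) (nu : probability Y R)
    (S : G -> Y -> Y) : Prop :=
  [/\ forall g, automorphism nu (S g),
      forall g h, {ae nu, forall y, S (g + h) y = S g (S h y)} &
      forall A, measurable A ->
        product_salgebra <<s @open G >> measurable
          ((fun p : G * Y => S p.1 p.2) @^-1` A)].

Definition skew_product (X Y G : Type) (T : X -> X) (phi : X -> G)
    (S : G -> Y -> Y) (p : X * Y) : X * Y :=
  (T p.1, S (phi p.1) p.2).

Definition dual_character (R : realType) (G : topologicalZmodType)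
    (chi : G -> R[i]^o) : Prop :=
  [/\ continuous chi, forall g h, chi (g + h) = chi g * chi h &
      forall g, `|chi g| = 1].

Definition L2_complex (R : realType) (d : measure_display)
    (Y : measurableType d) (nu : probability Y R) (f : Y -> R[i]^o) : Prop :=
  measurable_wrt measurable f /\
  (\int[nu]_y (Normc.normc (f y) ^+ 2)%:E < +oo)%E.

Definition eigenfunction (R : realType) (G : topologicalZmodType)
    (d : measure_display) (Y : measurableType d) (nu : probability Y R)
    (S : G -> Y -> Y) (f : Y -> R[i]^o) : Prop :=
  [/\ L2_complex nu f, ~ {ae nu, forall y, f y = 0} &
      exists2 chi : G -> R[i]^o, dual_character chi &
        forall h, {ae nu, forall y, f (S h y) = chi h * f y}].

Definition kronecker_factor (R : realType) (G : topologicalZmodType)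
    (d : measure_display) (Y : measurableType d) (nu : probability Y R)
    (S : G -> Y -> Y) : set (set Y) :=
  <<s [set A | exists (f : Y -> R[i]^o) (O : set R[i]^o),
         [/\ eigenfunction nu S f, open O & A = f @^-1` O]] >>.

(* h is a version of the conditional expectation E(f | F). *)
Definition is_condexp (R : realType) (d : measure_display)
    (Z : measurableType d) (P : probability Z R) (F : set (set Z))
    (f h : Z -> R) : Prop :=
  [/\ P.-integrable setT (EFin \o f), P.-integrable setT (EFin \o h),
      measurable_wrt F h &
      forall A, F A -> (\int[P]_(z in A) (f z)%:E = \int[P]_(z in A) (h z)%:E)%E].

Definition is_condexp_complex (R : realType) (d : measure_display)
    (Z : measurableType d) (P : probability Z R) (F : set (set Z))
    (f h : Z -> R[i]) : Prop :=
  is_condexp P F (fun z => complex.Re (f z)) (fun z => complex.Re (h z)) /\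
  is_condexp P F (fun z => complex.Im (f z)) (fun z => complex.Im (h z)).

(* A map on the quotient Z/F is encoded as an F-measurable map on Z. *)
Definition relative_eigenfunction (R : realType) (d : measure_display)
    (Z : measurableType d) (P : probability Z R) (tau : Z -> Z)
    (F : set (set Z)) (n : nat) (c : Z -> 'M[R[i]]_n) (M : Z -> 'cV[R[i]]_n) :
    Prop :=
  [/\ forall z, c z \is unitarymx,
      forall i j, measurable_wrt F (fun z => c z i j : R[i]^o),
      forall i, measurable_wrt measurable (fun z => M z i ord0 : R[i]^o),
      {ae P, forall z, c z *m M z = M (tau z)} &
      (forall i j, i != j ->
         is_condexp_complex P F (fun z => M z i ord0 * Num.conj (M z j ord0))
           (fun=> 0)) /\
      (forall i,
         is_condexp_complex P F (fun z => `|M z i ord0| ^+ 2) (fun=> 1))].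

Definition relative_kronecker_factor (R : realType) (d : measure_display)
    (Z : measurableType d) (P : probability Z R) (tau : Z -> Z)
    (F : set (set Z)) : set (set Z) :=
  <<s F `|`
    [set A | exists (n : nat) (c : Z -> 'M[R[i]]_n) (M : Z -> 'cV[R[i]]_n)
               (i : 'I_n) (O : set R[i]^o),
       [/\ (0 < n)%N, relative_eigenfunction P tau F c M, open O &
           A = (fun z => M z i ord0 : R[i]^o) @^-1` O]] >>.

Definition eq_mod_null (R : realType) (d : measure_display)
    (Z : measurableType d) (P : probability Z R) (F H : set (set Z)) : Prop :=
  (forall A, F A -> exists2 B, H B & P.-negligible (A `+` B)) /\
  (forall B, H B -> exists2 A, F A & P.-negligible (A `+` B)).

(* Main.v *)
(* An eigenfunction f of the action has constant modulus by ergodicity, so f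
   lifts to a relative eigenfunction with n = 1 and c = chi o phi.

   Conversely fix a unitary cocycle c of size n over X. A "relative section" is
   a matrix W of functions on X * Y, with n columns, such that
   W o tau = W c^T, tau being the skew product. If W and U are relative
   sections then W U^* is tau-invariant, hence constant. The maps (x, y) |->
   (x, S_h y) commute with tau and preserve c, so they act on relative
   sections. Rows orthonormal for the constant Gram matrix are orthonormal at
   almost every point, so there are at most n of them; a maximal orthonormal
   section W spans all sections, and W o S_h = B(h) W for commuting unitary
   constant matrices B(h). Diagonalizing them, every entry f of W satisfies
   f (x, S_h y) = chi(h) f (x, y). Averaging f over a suitable subset of X gives
   an eigenfunction F of the action, and f conj(F) is invariant under all S_h,
   hence depends on x only; as |F| is constant, f (x, y) = q(x) F(y).

   The eigenvalue chi of F is a Borel homomorphism to the unit circle; it is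
   continuous by Pettis' lemma and the Baire category theorem in G. *)
Require Import Defs.
From HB Require Import structures.
From mathcomp Require Import all_boot all_order all_algebra.
From mathcomp Require Import complex.
From mathcomp Require Import all_classical all_reals all_analysis.
From mathcomp Require Import measurable_realfun ring lra.

Set Implicit Arguments.
Unset Strict Implicit.
Unset Printing Implicit Defensive.

Import Order.TTheory GRing.Theory Num.Theory numFieldNormedType.Exports.
Local Open Scope classical_set_scope.
Local Open Scope ring_scope.

(** * Measurability of complex functions *)

Section complex_measurability.
Context {R : realType}.

(** Real and imaginary parts are tested separately so that closure properties of real measurable
    functions carry over; [measurable_wrtE] shows that this is Borel measurability. *)
Definition complex_measurable d (Z : measurableType d) (f : Z -> R[i]) :=
  measurable_fun setT (fun z => complex.Re (f z)) /\
  measurable_fun setT (fun z => complex.Im (f z)).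

Lemma ball_complexE (z w : R[i]^o) (e : R) :
  ball z e%:C%C w <-> Normc.normc (z - w) < e.
Proof. by rewrite -ball_normE /ball_ /= ltcR. Qed.

Lemma open_complexP (O : set R[i]^o) :
  open O <-> forall z, O z ->
    exists2 e : R, 0 < e & forall w, Normc.normc (z - w) < e -> O w.
Proof.
rewrite openE; split => [oO z Oz|oO z Oz].
  have /nbhs_ballP[[a b] /= e0 He] := oO z Oz.
  (* Radii in R[i]^o are complex numbers; a positive one has zero imaginary part, hence is a real
     radius. *)
  move: e0; rewrite ltcE /= => /andP[/eqP b0 a0]; subst b.
  by exists a => // w zw; apply: He; apply/ball_complexE.
have [e e0 He] := oO z Oz; apply/nbhs_ballP; exists e%:C%C; first by rewrite /= ltcR.
by move=> w /ball_complexE; exact: He.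
Qed.

Lemma normc_geRe (z : R[i]) : `|complex.Re z| <= Normc.normc z.
Proof. by case: z => a b; rewrite -sqrtr_sqr ler_wsqrtr// lerDl sqr_ge0. Qed.

Lemma normc_geIm (z : R[i]) : `|complex.Im z| <= Normc.normc z.
Proof. by case: z => a b; rewrite -sqrtr_sqr ler_wsqrtr// lerDr sqr_ge0. Qed.

Lemma normc_leReIm (z : R[i]) :
  Normc.normc z <= `|complex.Re z| + `|complex.Im z|.
Proof.
case: z => a b /=; rewrite -[leRHS]ger0_norm ?addr_ge0// -sqrtr_sqr ler_wsqrtr//.
by rewrite sqrrD !real_normK ?num_real// lerD2r lerDl mulrn_wge0// mulr_ge0.
Qed.

(** Open half-planes give measurability of both parts. Conversely, an open set is the union of the
    countably many rational squares that it contains. *)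
Lemma measurable_wrtE d (Z : measurableType d) (f : Z -> R[i]) :
  measurable_wrt measurable (f : Z -> R[i]^o) <-> complex_measurable f.
Proof.
split=> [mf|[mRe mIm] O /open_complexP oO].
  split; apply: (measurability _ (measurable_realfun.RGenOInfty.measurableE R));
    move=> _ [_ [x ->] <-]; rewrite setTI.
  - suff oO : open ([set z | x < complex.Re z] : set R[i]^o).
      rewrite (_ : _ @^-1` _ = f @^-1` [set z | x < complex.Re z]); first exact: mf.
      by apply/seteqP; split => z /=; rewrite in_itv/= andbT.
    apply/open_complexP => z /= xz; exists (complex.Re z - x); first by rewrite subr_gt0.
    move=> w zw; have := le_lt_trans (normc_geRe _) zw.
    by case: z w xz {zw} => [a b] [a' b'] /= xa; rewrite ltr_distlC ?subKr => /andP[? _]; lra.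
  - suff oO : open ([set z | x < complex.Im z] : set R[i]^o).
      rewrite (_ : _ @^-1` _ = f @^-1` [set z | x < complex.Im z]); first exact: mf.
      by apply/seteqP; split => z /=; rewrite in_itv/= andbT.
    apply/open_complexP => z /= xz; exists (complex.Im z - x); first by rewrite subr_gt0.
    move=> w zw; have := le_lt_trans (normc_geIm _) zw.
    by case: z w xz {zw} => [a b] [a' b'] /= xa; rewrite ltr_distlC ?subKr => /andP[? _]; lra.
pose box (t : rat * rat * rat) : set R[i] := [set z |
  (complex.Re z \in `](ratr t.1.1 - ratr t.2 : R), ratr t.1.1 + ratr t.2[ ) /\
  complex.Im z \in `](ratr t.1.2 - ratr t.2 : R), ratr t.1.2 + ratr t.2[ ].
rewrite (_ : _ @^-1` _ =
    \bigcup_t (if `[< box t `<=` O >] then f @^-1` (box t) else set0)).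
  apply: countable_bigcupT_measurable => [|t]; first exact: countableP.
  case: ifP => // _.
  rewrite [X in measurable X](_ : _ =
    ((fun z => complex.Re (f z)) @^-1`
        `](ratr t.1.1 - ratr t.2 : R), ratr t.1.1 + ratr t.2[%classic) `&`
    ((fun z => complex.Im (f z)) @^-1`
        `](ratr t.1.2 - ratr t.2 : R), ratr t.1.2 + ratr t.2[%classic)); last by [].
  by apply: measurableI; rewrite -[X in measurable X]setTI;
    [exact: mRe|exact: mIm].
apply/seteqP; split => [z /= Ofz|z [t _]]; last first.
  by case: ifP => // /asboolP bO; exact: bO.
have [e e0 He] := oO _ Ofz.
(* Two points of a square of half-side r < e / 4 differ by less than 2r in each coordinate, hence by
   less than e. *)
have [r] := @rat_in_itvoo R 0 (e / 4) ltac:(by rewrite divr_gt0).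
rewrite in_itv/= => /andP[r0 re].
have [p] := @rat_in_itvoo R (complex.Re (f z) - ratr r) (complex.Re (f z) + ratr r) ltac:(lra).
rewrite in_itv/= => /andP[p1 p2].
have [q] := @rat_in_itvoo R (complex.Im (f z) - ratr r) (complex.Im (f z) + ratr r) ltac:(lra).
rewrite in_itv/= => /andP[q1 q2].
exists (p, q, r) => //.
case: ifPn => [_|/asboolP[]] ; first by rewrite /= /box/= !in_itv/=; split; apply/andP; split; lra.
move=> w; rewrite /box/= !in_itv/= => -[/andP[w1 w2] /andP[w3 w4]]; apply: He.
apply: le_lt_trans (normc_leReIm _) _.
move: p1 p2 q1 q2 w1 w2 w3 w4; case: (f z) => a b; case: w => a' b' /= *.
have : `|a - a'| < ratr r + ratr r by rewrite ltr_norml; apply/andP; split; lra.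
have : `|b - b'| < ratr r + ratr r by rewrite ltr_norml; apply/andP; split; lra.
lra.
Qed.

Lemma complex_measurable_cst d (Z : measurableType d) (c : R[i]) :
  complex_measurable (fun _ : Z => c).
Proof. by split; exact: measurable_cst. Qed.

Lemma complex_measurable_comp d d' (Z : measurableType d) (Z' : measurableType d')
    (f : Z' -> R[i]) (t : Z -> Z') : complex_measurable f ->
  measurable_fun setT t -> complex_measurable (fun z => f (t z)).
Proof. by move=> [mRe mIm] mt; split; [exact: (measurableT_comp mRe mt)|exact: (measurableT_comp mIm mt)]. Qed.

Lemma complex_measurableD d (Z : measurableType d) (f g : Z -> R[i]) :
  complex_measurable f -> complex_measurable g ->
  complex_measurable (fun z => f z + g z).
Proof.
move=> [f1 f2] [g1 g2]; split.
  rewrite (_ : (fun _ => _) = (fun z => complex.Re (f z) + complex.Re (g z))).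
    exact: measurable_funD.
  by apply/funext => z; case: (f z) (g z) => ? ? [].
rewrite (_ : (fun _ => _) = (fun z => complex.Im (f z) + complex.Im (g z))).
  exact: measurable_funD.
by apply/funext => z; case: (f z) (g z) => ? ? [].
Qed.

Lemma complex_measurableM d (Z : measurableType d) (f g : Z -> R[i]) :
  complex_measurable f -> complex_measurable g ->
  complex_measurable (fun z => f z * g z).
Proof.
move=> [f1 f2] [g1 g2]; split.
  rewrite (_ : (fun _ => _) = (fun z => complex.Re (f z) * complex.Re (g z) -
      complex.Im (f z) * complex.Im (g z))).
    by apply: measurable_funB; exact: measurable_funM.
  by apply/funext => z; case: (f z) (g z) => ? ? [].
rewrite (_ : (fun _ => _) = (fun z => complex.Re (f z) * complex.Im (g z) +
    complex.Im (f z) * complex.Re (g z))).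
  by apply: measurable_funD; exact: measurable_funM.
by apply/funext => z; case: (f z) (g z) => ? ? [].
Qed.

Lemma complex_measurable_conj d (Z : measurableType d) (f : Z -> R[i]) :
  complex_measurable f -> complex_measurable (fun z => Num.conj (f z)).
Proof.
move=> [f1 f2]; split.
  by rewrite (_ : (fun _ => _) = (fun z => complex.Re (f z)))//;
    apply/funext => z; case: (f z).
rewrite (_ : (fun _ => _) = (fun z => - complex.Im (f z))).
  exact: measurableT_comp.
by apply/funext => z; case: (f z).
Qed.

Lemma complex_measurable_sum d (Z : measurableType d) (I : Type) (s : seq I)
    (f : I -> Z -> R[i]) : (forall i, complex_measurable (f i)) ->
  complex_measurable (fun z => \sum_(i <- s) f i z).
Proof.
move=> mf; elim: s => [|i s IH].
  by under eq_fun do rewrite big_nil; exact: complex_measurable_cst.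
by under eq_fun do rewrite big_cons; exact: complex_measurableD.
Qed.

Lemma measurable_real_eq d (Z : measurableType d) (f g : Z -> R) :
  measurable_fun setT f -> measurable_fun setT g ->
  measurable [set z | f z = g z].
Proof.
move=> /measurable_EFinP mf /measurable_EFinP mg.
have := measurable_eqe measurableT mf mg; rewrite setTI.
by congr measurable; apply/seteqP; split => z /= => [[]|->].
Qed.

Lemma measurable_complex_eq d (Z : measurableType d) (f g : Z -> R[i]) :
  complex_measurable f -> complex_measurable g ->
  measurable [set z | f z = g z].
Proof.
move=> [f1 f2] [g1 g2].
rewrite (_ : [set _ | _] =
    [set z | complex.Re (f z) = complex.Re (g z)] `&`
    [set z | complex.Im (f z) = complex.Im (g z)]).
  by apply: measurableI; exact: measurable_real_eq.
apply/seteqP; split => z /= => [->//|].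
by case: (f z) (g z) => a b [a' b'] /= [-> ->].
Qed.

End complex_measurability.

(** * Baire category and automatic continuity *)

Section baire_category.
Context {T : topologicalType}.

Definition meager (M : set T) := exists2 F : nat -> set T,
  (forall n, closed (F n) /\ interior (F n) = set0) & M `<=` \bigcup_n F n.

Lemma meagerS (M N : set T) : M `<=` N -> meager N -> meager M.
Proof. by move=> MN [F F0 NF]; exists F => //; exact: subset_trans NF. Qed.

Lemma meager_bigcup (I : countType) (M : I -> set T) :
  (forall i, meager (M i)) -> meager (\bigcup_i M i).
Proof.
move=> mM; have /choice[F FP] : forall i, exists F : nat -> set T,
    (forall n, closed (F n) /\ interior (F n) = set0) /\ M i `<=` \bigcup_n F n.
  by move=> i; have [F F0 MF] := mM i; exists F.
(* A single sequence runs through all pairs of indices; a number that codes no pair contributes the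
   empty set. *)
exists (fun n => if unpickle n is Some p then F p.1 p.2 else set0) => [n|x].
  case: (unpickle n) => [p|]; first exact: (FP p.1).1.
  by split; [exact: closed0|exact: interior0].
move=> [i _ Mx]; have [n _ Fx] := (FP i).2 _ Mx.
by exists (pickle (i, n)) => //; rewrite pickleK.
Qed.

Lemma meagerU (M N : set T) : meager M -> meager N -> meager (M `|` N).
Proof.
move=> mM mN; apply: (@meagerS _ (\bigcup_b (if b then M else N))) => [x []|].
- by exists true.
- by exists false.
- by apply: meager_bigcup => -[].
Qed.

Definition baire_property (A : set T) :=
  exists2 U : set T, open U & meager (A `+` U).

(** For complements, ~ U is replaced by its interior: the difference is closed and has empty
    interior. Countable unions of meager differences are meager. *)
Lemma baire_property_sigma_algebra : sigma_algebra setT baire_property.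
Proof.
split.
- exists set0; first exact: open0.
  exists (fun=> set0) => [n|x [[]|[]]//].
  by split; [exact: closed0|exact: interior0].
- move=> A [U oU mAU]; exists (interior (~` U)); first exact: open_interior.
  apply: (@meagerS _ ((A `+` U) `|` (~` U `\` interior (~` U)))).
    move=> x; rewrite setTD => -[[nA nI]|[/[dup] /interior_subset nU iU]].
      by have [Ux|nU] := pselect (U x); [left; right|right].
    by rewrite /= => /contrapT Ax; left; left.
  apply: meagerU => //; exists (fun=> ~` U `\` interior (~` U)) => [n|]; last first.
    by move=> x Dx; exists 0%N.
  split; first by apply: closedI; [exact: open_closedC|exact/open_closedC/open_interior].
  rewrite -subset0 => x; rewrite interiorI => -[Ix nI].
  exact: (interior_subset nI Ix).
- move=> A bA; have /choice[U UP] : forall n, exists U : set T, open U /\ meager (A n `+` U).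
    by move=> n; have [U] := bA n; exists U.
  exists (\bigcup_n U n); first by apply: bigcup_open => n _; exact: (UP n).1.
  apply: (@meagerS _ (\bigcup_n (A n `+` U n))).
    move=> x [[[n _ Ax] nU]|[[n _ Ux] nA]]; exists n => //.
      by left; split => // Ux; apply: nU; exists n.
    by right; split => // Ax; apply: nA; exists n.
  by apply: meager_bigcup => n; exact: (UP n).2.
Qed.

Lemma open_baire_property : <<s @open T >> `<=` baire_property.
Proof.
apply: smallest_sub; first exact: baire_property_sigma_algebra.
move=> U oU; exists U => //; exists (fun=> set0) => [n|x [[]|[]]//].
by split; [exact: closed0|exact: interior0].
Qed.

Hypothesis hT : hausdorff_space T.
Hypothesis lcT : locally_compact [set: T].

(** Local compactness and regularity of compact Hausdorff spaces provide the next set of the nested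
    sequence in the Baire argument. *)
Lemma open_closure_compact (O : set T) x : open O -> O x ->
  exists V, [/\ open V, V x, closure V `<=` O & compact (closure V)].
Proof.
move=> oO Ox; have [K] := lcT (I : setT x); rewrite withinET => nK [cK clK].
have [W nW WO] : filter_from (nbhs x) closure (O `&` K).
  by apply: (compact_regular hT cK nK); apply: filterI => //; exact: open_nbhs_nbhs.
have clW : closure (interior W) `<=` O `&` K.
  by apply: subset_trans WO; apply: closureS; exact: interior_subset.
exists (interior W); split.
- exact: open_interior.
- exact: nW.
- by move=> y /clW[].
- by apply: (subclosed_compact (@closed_closure _ _) cK) => y /clW[].
Qed.

(** Baire category theorem: choose nonempty open sets, the closure of each one lying inside the
    previous one and missing the next [F n]. By compactness some point lies in all the closures, so
    it is in [O] but in no [F n]. *)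
Lemma open_not_meager (O : set T) : open O -> O !=set0 -> ~ meager O.
Proof.
move=> oO [x0 Ox0] [F F0 OF].
have step (V : {V : set T | open V /\ V !=set0}) (n : nat) :
    exists W : {V : set T | open V /\ V !=set0},
    closure (sval W) `<=` sval V `\` F n /\ compact (closure (sval W)).
  have [cF iF] := F0 n.
  have [y Vy] : (sval V `\` F n) !=set0.
    apply: contrapT => /set0P/negP/negPn/eqP VF.
    have [oV [y Vy]] := svalP V.
    suff : interior (F n) y by rewrite iF.
    rewrite /interior/= nbhsE/=; exists (sval V) => // z Vz.
    by apply: contrapT => nF; have : (sval V `\` F n) z by []; rewrite VF.
  have oVF : open (sval V `\` F n).
    by apply: openI; [exact: (svalP V).1|exact: closed_openC].
  have [W [oW Wy WV cW]] := open_closure_compact oVF Vy.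
  by exists (exist _ W (conj oW (ex_intro _ y Wy))).
have [f fP] := choice (fun p : {V : set T | open V /\ V !=set0} * nat => step p.1 p.2).
pose V := fix V n := if n is n.+1 then f (V n, n) else
  exist (fun V : set T => open V /\ V !=set0) O (conj oO (ex_intro _ x0 Ox0)).
have VS n : closure (sval (V n.+1)) `<=` sval (V n) `\` F n by exact: (fP (V n, n)).1.
have VS1 n : sval (V n.+1) `<=` sval (V n).
  by move=> x /(@subset_closure _ _) /VS [].
have Vn m n : (m <= n)%N -> sval (V n) `<=` sval (V m).
  elim: n => [|n IH]; first by rewrite leqn0 => /eqP ->.
  rewrite leq_eqVlt => /predU1P[->//|]; rewrite ltnS => /IH; apply: subset_trans.
  exact: VS1.
pose FF := filter_from [set: nat] (fun n => sval (V n)).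
have pFF : ProperFilter FF.
  apply: filter_from_proper => [|n _]; last exact: (svalP (V n)).2.
  apply: filter_fromT_filter; first by exists 0%N.
  by move=> i j; exists (maxn i j) => x Vx; split; apply: Vn Vx;
    rewrite ?leq_maxl ?leq_maxr.
have FV n : FF (sval (V n)) by exists n.
(* Compactness is taken from [V 1], as the closure of [V 0], that is of [O], need not be compact. *)
have [p [_ clp]] : closure (sval (V 1%N)) `&` cluster FF !=set0.
  by apply: (fP (V 0%N, 0%N)).2; apply: filterS (FV 1%N); exact: subset_closure.
have pV n : closure (sval (V n)) p.
  by move=> B nB; exact: clp.
have [n _ Fp] := OF _ (VS 0%N p (pV 1%N)).1.
by have [] := VS n p (pV n.+1).
Qed.

End baire_category.

Section automatic_continuity.
Context {R : realType} {G : topologicalZmodType}.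
Hypothesis hG : hausdorff_space G.
Hypothesis lcG : locally_compact [set: G].

Lemma subr_continuous (g : G) : continuous (fun x : G => x - g).
Proof.
move=> x; apply: (@continuous_comp _ _ _ (fun x => (x, g)) (fun x : G * G => x.1 - x.2)).
  by apply: cvg_pair => /=; [exact: cvg_id|exact: cvg_cst].
exact: sub_continuous.
Qed.

Lemma addr_continuous (g : G) : continuous (fun x : G => x + g).
Proof. by rewrite -[g]opprK; exact: subr_continuous. Qed.

Lemma meager_shift (g : G) (M : set G) : meager M -> meager [set x | M (x - g)].
Proof.
move=> [F F0 MF]; exists (fun n => [set x | F n (x - g)]) => [n|x Mx]; last first.
  by have [n _ Fn] := MF _ Mx; exists n.
have [cF iF] := F0 n; split.
  refine (@preimage_closed G G (fun x : G => x - g) (F n) _ cF) => x _.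
  exact: (@subr_continuous g x).
rewrite -subset0 => x nF; suff : interior (F n) (x - g) by rewrite iF.
have := @addr_continuous g (x - g); rewrite /continuous_at subrK => /(_ _ nF).
move=> nFg; change (nbhs (x - g) (F n)).
by apply: (@filterS _ (nbhs (x - g)) _ _ _ _ nFg) => y /=; rewrite addrK.
Qed.

(** Let A agree with an open U up to a meager set. For g near 0 the open set U [&] (U + g) is
    nonempty, hence not meager, so some x in it has both x and x - g outside the exceptional set.
    Then x and x - g lie in A, and g is their difference. *)
Lemma pettis (A : set G) : <<s @open G >> A -> ~ meager A ->
  \forall g \near (0 : G), exists a b, [/\ A a, A b & g = a - b].
Proof.
move=> /open_baire_property[U oU mAU] nmA.
have [u Uu] : U !=set0.
  apply: contrapT => U0; apply: nmA; apply: meagerS mAU => x Ax; left; split => //.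
  by move=> Ux; apply: U0; exists x.
have : nbhs u U by exact: open_nbhs_nbhs.
have := @addr_continuous u 0; rewrite /continuous_at add0r => /[apply] /= nU.
near=> g.
have Ug : U (g + u) by near: g.
pose W := U `&` [set x | U (x - g)].
have oW : open W.
  apply: openI => //; refine (@open_comp G G (fun x : G => x - g) U _ oU) => x _.
  exact: (@subr_continuous g x).
have : ~ (W `<=` (A `+` U) `|` [set x | (A `+` U) (x - g)]).
  move=> WM; apply: (open_not_meager hG lcG oW).
    by exists (g + u); split => //=; rewrite addrAC subrr add0r.
  by apply: (meagerS WM); apply: meagerU => //; exact: meager_shift.
move=> /existsNP[x /not_implyP[[Ux Uxg]]] /not_orP[nx nxg].
exists x, (x - g); split; last by rewrite subKr.
- by apply: contrapT => nAx; apply: nx; right.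
- by apply: contrapT => nAx; apply: nxg; right.
Unshelve. all: by end_near. Qed.

(* Countably many balls of radius e / 2 cover the complex numbers, so one of
   their preimages is not meager, and Pettis' lemma applies to it. *)
Lemma measurable_character_continuous (chi : G -> R[i]^o) :
  (forall O : set R[i]^o, open O -> <<s @open G >> (chi @^-1` O)) ->
  (forall g h, chi (g + h) = chi g * chi h) -> (forall g, `|chi g| = 1) ->
  continuous chi.
Proof.
move=> mchi chiD chi1.
have nchi g : Normc.normc (chi g) = 1 by have [] := chi1 g.
(* Continuity at 0 suffices, as |chi x - chi y| = |1 - chi (y - x)|. *)
suff chi0 (e : R) : 0 < e ->
    \forall g \near (0 : G), Normc.normc (1 - chi g) < e.
  move=> x; apply/cvgrPdist_lt => -[a b]; rewrite ltcE/= => /andP[/eqP b0 a0].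
  subst b; have := @subr_continuous x x; rewrite /continuous_at subrr.
  move=> /(_ _ (chi0 _ a0)) nb; apply: (@filterS _ (nbhs x) _ _ _ _ nb) => y /= xy.
  rewrite ltcR -[y](subrK x) chiD -{1}[chi x]mul1r -mulrBl.
  by rewrite Normc.normcM nchi mulr1.
move=> e0.
pose A (t : rat * rat) : set G := chi @^-1` [set w : R[i]^o |
  Normc.normc (((ratr t.1 : R) +i* (ratr t.2 : R))%C - w) < e / 2].
have mA t : <<s @open G >> (A t).
  apply: mchi; apply/open_complexP => w /= wt.
  exists (e / 2 - Normc.normc (((ratr t.1 : R) +i* (ratr t.2 : R))%C - w)).
    by rewrite subr_gt0.
  move=> w' ww'; set c := (_ +i* _)%C in wt ww' *.
  have -> : c - w' = (c - w) + (w - w') by rewrite addrA subrK.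
  by apply: le_lt_trans (le_normcD _ _) _; rewrite addrC -ltrBrDr.
have [t nA] : exists t, ~ meager (A t).
  apply: contrapT => /forallNP mm.
  apply: (@open_not_meager G hG lcG setT openT); first by exists 0.
  apply: (@meagerS _ _ (\bigcup_t A t)); last first.
    by apply: meager_bigcup => t; apply: contrapT; exact: mm.
  move=> g _; case E : (chi g) => [a b].
  have [p] := @rat_in_itvoo R (a - e / 4) (a + e / 4) ltac:(lra).
  rewrite in_itv/= => /andP[p1 p2].
  have [q] := @rat_in_itvoo R (b - e / 4) (b + e / 4) ltac:(lra).
  rewrite in_itv/= => /andP[q1 q2].
  exists (p, q) => //; rewrite /A/= E.
  apply: le_lt_trans (normc_leReIm _) _ => /=.
  have : `|ratr p - a| < e / 4 by rewrite ltr_norml; apply/andP; split; lra.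
  have : `|ratr q - b| < e / 4 by rewrite ltr_norml; apply/andP; split; lra.
  lra.
(* For g = a - b, |1 - chi g| = |chi b - chi a|, and both values are within e / 2 of the centre of
   the ball. *)
apply: filterS (pettis (mA t) nA) => _ [a [b [Aa Ab ->]]].
rewrite -[X in X < _]mulr1 -(nchi b) -Normc.normcM mulrBl mul1r -chiD subrK.
set c := ((ratr t.1 : R) +i* (ratr t.2 : R))%C in Aa Ab.
have -> : chi b - chi a = (c - chi a) - (c - chi b) by rewrite opprB [RHS]addrC addrA subrK.
apply: le_lt_trans (le_normcD _ _) _.
by rewrite normcN; move: Aa Ab; rewrite /A /= -/c; lra.
Qed.

End automatic_continuity.

(** * Commuting families of matrices *)

Section commuting_matrices.
Local Open Scope sesquilinear_scope.

(** A finite subfamily whose span has maximal dimension spans every member. It reduces a family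
    indexed by a whole group to a finite list that can be trigonalized simultaneously. *)
Lemma finite_spanning_family (F : fieldType) (V : vectType F) (I : choiceType)
    (v : I -> V) : exists s : seq I, forall i, v i \in <<map v s>>%VS.
Proof.
pose d k := `[< exists s : seq I, \dim <<map v s>> = k >].
have d0 : exists k, d k by exists (\dim <<map v [::]>>); apply/asboolP; exists [::].
have dub k : d k -> (k <= \dim {:V})%N.
  by move=> /asboolP[s <-]; exact/dimvS/subvf.
case: (ex_maxnP d0 dub) => k /asboolP[s sk] maxk; exists s => i.
have ik : (\dim <<map v (i :: s)>> <= k)%N by apply: maxk; apply/asboolP; exists (i :: s).
have sub : (<<map v s>> <= <<map v (i :: s)>>)%VS.
  by apply: sub_span => w ws; rewrite inE ws orbT.
have /eqP -> : <<map v s>>%VS == <<map v (i :: s)>>%VS by rewrite eqEdim sub sk.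
by apply: memv_span; rewrite inE eqxx.
Qed.

(* If the adjoint of a triangular matrix of the family is again triangular in
   the same basis, the matrix is diagonal there. *)
Lemma unitary_codiagonalization (C : numClosedFieldType) (r : nat)
    (I : choiceType) (B : I -> 'M[C]_r) :
  (forall i j, B i *m B j = B j *m B i) ->
  (forall i, exists j, B j = (B i) ^t*) ->
  exists2 P : 'M[C]_r, P \is unitarymx &
    forall i, is_diag_mx (P *m B i *m P ^t*).
Proof.
move=> comB adjB; have [s sB] := finite_spanning_family B.
have [_ _ /mapP[i _ ->] /mapP[j _ ->]|P uP /allP/= PB] :=
  @cotrigonalization C r (map B s); first exact: comB.
(* Being triangular in the basis P is a linear condition, so it passes from the finite list to its
   span. *)
have trigB i : is_trig_mx (P *m B i *m P ^t*).
  apply/is_trig_mxP => j k jk; rewrite (coord_span (X := in_tuple (map B s)) (sB i)).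
  rewrite mulmx_sumr mulmx_suml summxE big1// => l _.
  rewrite -scalemxAr -scalemxAl mxE.
  have /PB /is_trig_mxP : (in_tuple (map B s))`_l \in map B s.
    by apply: mem_nth.
  by rewrite conjymx// => ->//; rewrite mulr0.
exists P => // i; apply/is_diag_mxP => j k; case: ltngtP => // [jk|kj] _.
  exact: (is_trig_mxP (trigB i)).
have [l Bl] := adjB i.
have /is_trig_mxP/(_ k j kj)/eqP := trigB l; rewrite Bl.
have -> : P *m B i ^t* *m P ^t* = (P *m B i *m P ^t*) ^t*.
  by rewrite !trmx_mul !map_mxM trmxCK mulmxA.
by rewrite 2!mxE conjC_eq0 => /eqP.
Qed.

End commuting_matrices.

(** * Null sets and integrals on a product *)

Section product_ae.
Context {R : realType} {d1 d2 : measure_display} {X : measurableType d1}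
  {Y : measurableType d2}.
Variables (mu : probability X R) (nu : probability Y R).

Lemma ge0_integral_eq0_ae d (T : measurableType d) (m : probability T R)
    (f : T -> \bar R) : measurable_fun setT f -> (forall x, 0 <= f x)%E ->
  (\int[m]_x f x = 0)%E -> {ae m, forall x, f x = 0%E}.
Proof.
move=> mf f0 intf; have : (\int[m]_x `|f x| = 0)%E.
  by rewrite -[RHS]intf; apply: eq_integral => x _; rewrite gee0_abs.
move=> /(ae_eq_integral_abs m measurableT mf).
by apply: filterS => x /(_ I).
Qed.

Lemma ae_xsection (Q : X * Y -> Prop) : {ae (mu \x nu)%E, forall z, Q z} ->
  {ae mu, forall x, {ae nu, forall y, Q (x, y)}}.
Proof.
move=> [N [mN N0 QN]].
have mI : measurable_fun setT (EFin \o (\1_N : X * Y -> R)).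
  exact/measurable_EFinP.
have I0 z : (0 <= (EFin \o (\1_N : X * Y -> R)) z)%E by rewrite lee_fin.
have := fubini_tonelli1 (m1 := mu) (m2 := nu) _ mI I0.
rewrite integral_indic// setIT => /esym NF; have /ge0_integral_eq0_ae FN := etrans NF N0.
have := FN (measurable_fun_fubini_tonelli_F _ mI I0)
  ltac:(by move=> x; apply: integral_ge0 => y _; exact: I0).
apply: filterS => x /ge0_integral_eq0_ae FxN.
have := FxN ltac:(exact: measurableT_comp) ltac:(by move=> y; exact: I0).
apply: filterS => y /= [] /eqP.
rewrite indicE pnatr_eq0 eqb0 => /negP nN; apply: contrapT => nQ; apply: nN.
by rewrite inE; exact: QN.
Qed.

Lemma ae_ysection (Q : X * Y -> Prop) : {ae (mu \x nu)%E, forall z, Q z} ->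
  {ae nu, forall y, {ae mu, forall x, Q (x, y)}}.
Proof.
move=> [N [mN N0 QN]].
have mI : measurable_fun setT (EFin \o (\1_N : X * Y -> R)).
  exact/measurable_EFinP.
have I0 z : (0 <= (EFin \o (\1_N : X * Y -> R)) z)%E by rewrite lee_fin.
have := fubini_tonelli2 (m1 := mu) (m2 := nu) _ mI I0.
rewrite integral_indic// setIT => /esym NF; have /ge0_integral_eq0_ae FN := etrans NF N0.
have := FN (measurable_fun_fubini_tonelli_G _ mI I0)
  ltac:(by move=> x; apply: integral_ge0 => y _; exact: I0).
apply: filterS => x /ge0_integral_eq0_ae FxN.
have := FxN ltac:(exact: measurableT_comp) ltac:(by move=> y; exact: I0).
apply: filterS => y /= [] /eqP.
rewrite indicE pnatr_eq0 eqb0 => /negP nN; apply: contrapT => nQ; apply: nN.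
by rewrite inE; exact: QN.
Qed.

(** Converse of [ae_xsection] for measurable events. It turns identities known for each group
    element and almost every y into identities along the skew product, the element being phi x. *)
Lemma xsection_ae (Q : X * Y -> Prop) : measurable [set z | Q z] ->
  {ae mu, forall x, {ae nu, forall y, Q (x, y)}} ->
  {ae (mu \x nu)%E, forall z, Q z}.
Proof.
move=> mQ aeQ; exists (~` [set z | Q z]); split => //; first exact: measurableC.
have mC := measurableC mQ.
transitivity (\int[mu]_x (cst 0 x : \bar R))%E; last by rewrite integral0.
apply: ae_eq_integral => //; first exact: measurable_fun_xsection.
apply: filterS aeQ => x aeQx _ /=.
apply/negligibleP; first exact: measurable_xsection.
by apply: negligibleS aeQx => y; rewrite /xsection/= inE.
Qed.

Lemma ae_nonempty d (T : measurableType d) (m : probability T R) (Q : T -> Prop) :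
  {ae m, forall x, Q x} -> exists x, Q x.
Proof.
move=> aeQ; apply: contrapT => /forallNP nQ.
have : m.-negligible setT by apply: negligibleS aeQ => x _ /=.
move/(negligibleP m measurableT)/(etrans (esym (probability_setT m)))/eqP.
by rewrite eqe oner_eq0.
Qed.

Lemma ae_snd (Q : Y -> Prop) : {ae (mu \x nu)%E, forall z, Q z.2} ->
  {ae nu, forall y, Q y}.
Proof. by move=> /ae_ysection; apply: filterS => y /ae_nonempty[]. Qed.

(** Rectangles are stable under intersection and generate the product sigma-algebra, and the sets of
    zero integral form a Dynkin system; so the integral over every measurable set vanishes. *)
Lemma integral_rectangles_eq0 (f : X * Y -> R) :
  (mu \x nu)%E.-integrable setT (EFin \o f) ->
  (forall A B, measurable A -> measurable B ->
    \int[(mu \x nu)%E]_(z in A `*` B) (f z)%:E = 0)%E ->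
  {ae (mu \x nu)%E, forall z, f z = 0}.
Proof.
move=> intf f0.
have fE E : measurable E -> (\int[(mu \x nu)%E]_(z in E) (f z)%:E = 0)%E.
  rewrite measurable_prod_measurableType; move: E.
  apply: (@dynkin_induction _ (X * Y)%type
      [set A `*` B | A in measurable & B in measurable]
      (fun E => \int[(mu \x nu)%E]_(z in E) (f z)%:E = 0)%E).
  - exact: measurable_prod_measurableType.
  - move=> _ _ [A mA [B mB <-]] [A' mA' [B' mB' <-]].
    by exists (A `&` A'); [exact: measurableI|exists (B `&` B'); [exact: measurableI|rewrite setXI]].
  - by rewrite -setXTT; exact: f0.
  - by move=> _ [A mA [B mB <-]]; exact: f0.
  - move=> S mS IS.
    have := @integral_setU _ _ _ (mu \x nu)%E S (~` S) (EFin \o f) mS (measurableC mS).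
    rewrite setUv IS add0e => <-.
    + by rewrite -setXTT; exact: f0.
    + exact: measurable_int intf.
    + by rewrite disj_set2E setICr.
  - move=> F mF tF IF; rewrite integral_bigcup//.
    + by rewrite eseries0// => n _ _; exact: IF.
    + by apply: integrableS intf => //; exact: bigcup_measurable.
have /(_ _ _)/filterS := integral_ae_eq (mu := (mu \x nu)%E) measurableT intf (g := cst 0%E).
apply=> [||E _ mE]; last by rewrite fE// integral0.
- by move=> z /(_ I)[].
- exact: measurable_cst.
Qed.

End product_ae.

(** * Ergodicity *)

Section ergodicity.
Context {R : realType} d (Z : measurableType d) (m : probability Z R) (tau : Z -> Z).
Hypothesis mtau : measurable_fun setT tau.
Hypothesis etau : ergodic m tau.

Lemma ergodic_zero_one (A : set Z) : measurable A ->
  {ae m, forall z, A (tau z) <-> A z} ->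
  {ae m, forall z, ~ A z} \/ {ae m, forall z, A z}.
Proof.
move=> mA invA.
have mtA : measurable (tau @^-1` A) by rewrite -[X in measurable X]setTI; exact: mtau.
have : m ((tau @^-1` A) `+` A) = 0%E.
  apply/negligibleP; first by apply: measurableU; exact: measurableD.
  apply: negligibleS invA => z [[Atz nAz]|[Az nAtz]] [H1 H2].
    by apply: nAz; exact: H1.
  by apply: nAtz; exact: H2.
move=> /(etau mA)[A0|A1].
  left; apply/negligibleP.
    by rewrite (_ : ~` _ = A)//; apply/seteqP; split => z /=; [exact: contrapT|move=> ? ?].
  by rewrite (_ : ~` _ = A)//; apply/seteqP; split => z /=; [exact: contrapT|move=> ? ?].
right; apply/negligibleP; first exact: measurableC.
by rewrite [LHS]probability_setC// A1 subee.
Qed.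

(** Every sublevel set is null or of full measure. The constant is the supremum of the almost sure
    lower bounds. *)
Lemma ergodic_real_constant (f : Z -> R) : measurable_fun setT f ->
  {ae m, forall z, f (tau z) = f z} -> exists c, {ae m, forall z, f z = c}.
Proof.
move=> mf invf.
have mA q : measurable [set z | f z < q].
  rewrite (_ : [set _ | _] = f @^-1` `]-oo, q[%classic).
    by rewrite -[X in measurable X]setTI; exact: mf.
  by apply/seteqP; split => z /=; rewrite in_itv.
have H q : {ae m, forall z, ~ f z < q} \/ {ae m, forall z, f z < q}.
  by apply: ergodic_zero_one (mA q) _; apply: filterS invf => z /= ->.
pose E := [set q | {ae m, forall z, ~ f z < q}].
(* If [E] were empty, some point z would satisfy f z < - n for all n; in the same way some [b] lies
   outside [E]. *)
have [a Ea] : E !=set0.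
  apply: contrapT => /forallNP nE.
  have : {ae m, forall z, forall n : nat, f z < - n%:R}.
    by apply: ae_foralln => n; have [/nE|] := H (- n%:R).
  move=> /ae_nonempty[z fz]; have := fz (Num.truncn `|f z|).+1.
  have := truncnS_gt `|f z|; have := ler_norm (- f z); rewrite normrN; lra.
have [b nEb] : exists b, ~ E b.
  apply: contrapT => /forallNP nE.
  have : {ae m, forall z, forall n : nat, ~ f z < n%:R}.
    by apply: ae_foralln => n; apply: contrapT; exact: nE.
  move=> /ae_nonempty[z fz]; apply: (fz (Num.truncn `|f z|).+1).
  have := truncnS_gt `|f z|; have := ler_norm (f z); lra.
have Eb : ubound E b.
  move=> q Eq; rewrite leNgt; apply/negP => bq; apply: nEb.
  by apply: filterS Eq => z nfq fb; apply: nfq; exact: lt_trans bq.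
have supE : has_sup E by split; [exists a|exists b].
exists (sup E).
have lo : {ae m, forall z, forall n : nat, ~ f z < sup E - n.+1%:R^-1}.
  apply: ae_foralln => n.
  have n0 : 0 < n.+1%:R^-1 :> R by rewrite invr_gt0.
  have [q Eq qn] := sup_adherent n0 supE.
  by apply: filterS Eq => z nfq fb; apply: nfq; exact: lt_trans qn.
have hi : {ae m, forall z, forall n : nat, f z < sup E + n.+1%:R^-1}.
  apply: ae_foralln => n; have [Ec|//] := H (sup E + n.+1%:R^-1).
  by have := ub_le_sup supE.2 Ec; rewrite gerDl leNgt invr_gt0 ltr0n.
apply: filterS2 lo hi => z lo hi; apply/eqP; rewrite eq_le; apply/andP; split.
  apply/ler_addgt0Pr => e e0; have := hi (Num.truncn e^-1).
  have := truncnS_gt e^-1.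
  rewrite -[X in _ < X -> _]invrK ltf_pV2 ?posrE ?invr_gt0 ?ltr0n// => He Hz.
  by apply/ltW/(lt_trans Hz); rewrite ltrD2l.
apply/ler_addgt0Pr => e e0; have := lo (Num.truncn e^-1).
have := truncnS_gt e^-1.
rewrite -[X in _ < X -> _]invrK ltf_pV2 ?posrE ?invr_gt0 ?ltr0n// => He /negP.
rewrite -leNgt lerBlDr => Hz.
by apply: (le_trans Hz); rewrite lerD2l ltW.
Qed.

Lemma ergodic_constant (f : Z -> R[i]) : complex_measurable f ->
  {ae m, forall z, f (tau z) = f z} -> exists c, {ae m, forall z, f z = c}.
Proof.
move=> [f1 f2] invf.
have [a aeq] := ergodic_real_constant f1 ltac:(by apply: filterS invf => z /= ->).
have [b beq] := ergodic_real_constant f2 ltac:(by apply: filterS invf => z /= ->).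
exists (a +i* b)%C; apply: filterS2 aeq beq => z.
by case: (f z) => ? ? /= -> ->.
Qed.

End ergodicity.

(** * The group with its Borel sigma-algebra *)

Section borel_group.
Variable G : topologicalZmodType.

(** A synonym of [G] on which the Borel sigma-algebra is registered as a measurable structure, so
    that products with measurable spaces can be formed. *)
Definition borel_group : Type := G.

HB.instance Definition _ := Choice.on borel_group.
HB.instance Definition _ := isPointed.Build borel_group (0 : G).

Lemma borel_groupC (A : set G) : <<s @open G >> A -> <<s @open G >> (~` A).
Proof. by move=> mA; rewrite -setTD; exact: sigma_algebraCD. Qed.

HB.instance Definition _ := @isMeasurable.Build (sigma_display (@open G))
  borel_group <<s @open G >> (@sigma_algebra0 _ setT (@open G)) borel_groupC
  (@sigma_algebra_bigcup _ setT (@open G)).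

End borel_group.

(** * The skew product and the shifts of the fibres *)

Section skew.
Context {R : realType} {d1 d2 : measure_display} {X : measurableType d1}
  {Y : measurableType d2} {G : topologicalZmodType}.
Variables (mu : probability X R) (nu : probability Y R).
Variables (T : X -> X) (phi : X -> G) (S : G -> Y -> Y).

Definition fiber_shift (g : G) (z : X * Y) : X * Y := (z.1, S g z.2).

Hypothesis actS : measurable_action nu S.

Lemma action_measurable (g : G) : measurable_fun setT (S g).
Proof. by have [/(_ g)[]] := actS. Qed.

Lemma ae_action (g : G) (Q : Y -> Prop) :
  {ae nu, forall y, Q y} -> {ae nu, forall y, Q (S g y)}.
Proof.
move=> [N [mN N0 QN]]; exists (S g @^-1` N); split.
- by rewrite -[X in measurable X]setTI; exact: action_measurable.
- by have [/(_ g)[_ -> //]] := actS.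
- by move=> y /= nQ; exact: QN.
Qed.

Lemma action_comm (g h : G) : {ae nu, forall y, S g (S h y) = S h (S g y)}.
Proof.
have [_ SD _] := actS.
by apply: filterS2 (SD g h) (SD h g) => y <- <-; rewrite addrC.
Qed.

Lemma fiber_shift_measurable (g : G) : measurable_fun setT (fiber_shift g).
Proof.
apply/measurable_fun_pairP; split; first exact: measurable_fst.
by apply: measurableT_comp (action_measurable g) _; exact: measurable_snd.
Qed.

Lemma ae_fiber_shift (g : G) (Q : X * Y -> Prop) :
  {ae (mu \x nu)%E, forall z, Q z} ->
  {ae (mu \x nu)%E, forall z, Q (fiber_shift g z)}.
Proof.
move=> [N [mN N0 QN]].
have : {ae (mu \x nu)%E, forall z, (~` N) (fiber_shift g z)}.
  apply: xsection_ae.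
    rewrite -[X in measurable X]setTI; apply: fiber_shift_measurable => //.
    exact: measurableC.
  have : {ae (mu \x nu)%E, forall z, (~` N) z}.
    by exists N; split => // z /=; exact: contrapT.
  by move=> /ae_xsection; apply: filterS => x; exact: ae_action.
by apply: filterS => z nN; apply: contrapT => /QN.
Qed.

Hypothesis mT : measurable_fun setT T.
Hypothesis mphi : measurable_wrt measurable phi.

Local Notation Gm := (borel_group G).

(** The joint measurability of the action is composed with z |-> (p z, q z). Taking p = phi o fst
    gives the skew product, taking p = fst the action map itself. *)
Lemma joint_measurable (A : set Y) d (Z : measurableType d) (p : Z -> G) (q : Z -> Y) :
  measurable A -> (forall O, open O -> measurable (p @^-1` O)) ->
  measurable_fun setT q -> measurable ((fun z => S (p z) (q z)) @^-1` A).
Proof.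
move=> mA mp mq; have [_ _ /(_ A mA)] := actS.
have mpm : measurable_fun setT (p : Z -> Gm).
  by apply: (@measurability _ _ Z Gm setT p (@open G)) => // _ [U oU <-]; rewrite setTI; exact: mp.
rewrite /product_salgebra.
pose pq (z : Z) : Gm * Y := (p z, q z).
have mpq : measurable_fun setT pq by apply/measurable_fun_pairP; split.
rewrite -(@measurable_prod_measurableType _ _ Gm Y) => mSA.
have := mpq measurableT _ mSA; by rewrite setTI; apply.
Qed.

Lemma action_curry_measurable (A : set Y) :
  measurable A -> measurable ((fun p : Gm * Y => S p.1 p.2) @^-1` A).
Proof.
move=> mA; apply: joint_measurable => //.
move=> O oO; rewrite (_ : _ @^-1` _ = setT `&` (fst @^-1` (O : set Gm))); last by rewrite setTI.
by apply: measurable_fst => //; exact: sub_sigma_algebra.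
Qed.

Lemma skew_product_measurable : measurable_fun setT (skew_product T phi S).
Proof.
apply/measurable_fun_pairP; split; first exact: measurableT_comp mT measurable_fst.
move=> _ A mA; rewrite setTI; apply: joint_measurable => //.
move=> O oO; rewrite (_ : _ @^-1` _ = setT `&` (fst @^-1` (phi @^-1` O))); last by rewrite setTI.
by apply: measurable_fst => //; exact: mphi.
Qed.

(** Stated through a function [u] because the set where two complex measurable functions agree is
    measurable, as [xsection_ae] requires. *)
Lemma fiber_shift_skew_comm (g : G) (u : X * Y -> R[i]) : complex_measurable u ->
  {ae (mu \x nu)%E, forall z, u (fiber_shift g (skew_product T phi S z)) =
    u (skew_product T phi S (fiber_shift g z))}.
Proof.
move=> mu'; have mtau := skew_product_measurable.
have mg := fiber_shift_measurable g.
apply: xsection_ae.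
  apply: measurable_complex_eq.
    by apply: complex_measurable_comp (complex_measurable_comp mu' mg) mtau.
  by apply: complex_measurable_comp (complex_measurable_comp mu' mtau) mg.
apply: aeW => x /=; apply: filterS (action_comm g (phi x)) => y.
by rewrite /fiber_shift /skew_product/= => ->.
Qed.

Hypothesis ergTphiS : ergodic (mu \x nu)%E (skew_product T phi S).

(** Seen as a function of (x, y), an invariant p is invariant under the skew product; ergodicity of
    the latter thus gives ergodicity of the action. *)
Lemma action_constant (p : Y -> R[i]) : complex_measurable p ->
  (forall h, {ae nu, forall y, p (S h y) = p y}) ->
  exists c, {ae nu, forall y, p y = c}.
Proof.
move=> mp invp.
have mp2 : complex_measurable (fun z : X * Y => p z.2).
  by apply: complex_measurable_comp mp _; exact: measurable_snd.
have [|c pc] := ergodic_constant skew_product_measurable ergTphiS mp2.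
  apply: xsection_ae; last by apply: aeW => x; exact: (invp (phi x)).
  apply: measurable_complex_eq => //.
  exact: complex_measurable_comp mp2 skew_product_measurable.
by exists c; exact: ae_snd pc.
Qed.

End skew.

(** * Invariant functions and eigenfunctions of the action *)

Section partial_integrals.
Context {R : realType} {d1 d2 : measure_display} {X : measurableType d1}
  {Y : measurableType d2}.
Variables (mu : probability X R) (nu : probability Y R).

Lemma bounded_integrable d (Z : measurableType d) (m : probability Z R) (A : set Z)
    (f : Z -> R) (K : R) : measurable A -> measurable_fun setT f ->
  (forall z, `|f z| <= K) -> m.-integrable A (EFin \o f).
Proof.
move=> mA mf fK; apply: measurable_bounded_integrable => //.
- by rewrite (le_lt_trans (probability_le1 m mA))// ltry.
- exact: measurable_funS mf.
- exists K; split; first exact: num_real.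
  by move=> M KM z _; apply: le_trans (fK z) (ltW KM).
Qed.

Definition partial_integral (A : set X) (f : X * Y -> R) (y : Y) : R :=
  (\int[mu]_(x in A) f (x, y))%R.

Section bounded.
Variables (f : X * Y -> R) (K : R).
Hypotheses (mf : measurable_fun setT f) (fK : forall z, `|f z| <= K).

Lemma partial_integrable (A : set X) y : measurable A ->
  mu.-integrable A (fun x => (f (x, y))%:E).
Proof.
move=> mA; apply: (@bounded_integrable _ _ _ _ (fun x => f (x, y)) K) => //.
by apply: measurableT_comp.
Qed.

Lemma partial_integralE (A : set X) y : measurable A ->
  (partial_integral A f y)%:E = (\int[mu]_x ((f (x, y))%:E * (\1_A x)%:E))%E.
Proof.
move=> mA; rewrite /partial_integral /Rintegral fineK; last first.
  exact: integrable_fin_num (partial_integrable y mA).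
rewrite integral_mkcond; apply: eq_integral => x _.
by rewrite patchE indicE; case: ifP => _; rewrite ?mule1 ?mule0.
Qed.

Lemma measurable_partial_integral (A : set X) : measurable A ->
  measurable_fun setT (partial_integral A f).
Proof.
move=> mA; apply/measurable_EFinP.
pose g (z : X * Y) := f z * \1_A z.1.
have mg : measurable_fun setT g.
  apply: measurable_funM => //.
  by apply: measurableT_comp => //; exact: measurable_indic.
have ig : (mu \x nu)%E.-integrable setT (EFin \o g).
  apply: (@bounded_integrable _ _ _ _ g K) => // z; rewrite /g normrM indicE.
  by case: (_ \in _); rewrite ?normr1 ?mulr1// normr0 mulr0 (le_trans _ (fK z)).
have := measurable_fubini_G ig; congr measurable_fun.
by apply/funext => y; rewrite /= partial_integralE.
Qed.

Lemma normr_partial_integral (A : set X) y : measurable A ->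
  `|partial_integral A f y| <= K.
Proof.
move=> mA; have K0 : 0 <= K by rewrite (le_trans _ (fK (point, y))).
apply: le_trans (le_normr_Rintegral mA (partial_integrable y mA)) _.
apply: le_trans (_ : \int[mu]_(x in A) K <= _).
  apply: le_Rintegral => //.
    exact: integrable_norm (partial_integrable y mA).
  by apply: (@bounded_integrable _ _ _ _ (fun=> K) K) => // x; rewrite ger0_norm.
rewrite Rintegral_cst// ler_piMr// -lee_fin fineK; first exact: probability_le1.
by rewrite ge0_fin_numE// (le_lt_trans (probability_le1 mu mA))// ltry.
Qed.

Lemma integral_rectangle (A : set X) (B : set Y) : measurable A -> measurable B ->
  (\int[(mu \x nu)%E]_(z in A `*` B) (f z)%:E =
   \int[nu]_(y in B) (partial_integral A f y)%:E)%E.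
Proof.
move=> mA mB; pose g (z : X * Y) := f z * (\1_A z.1 * \1_B z.2).
have mg : measurable_fun setT g.
  apply: measurable_funM => //; apply: measurable_funM.
    by apply: measurableT_comp => //; exact: measurable_indic.
  by apply: measurableT_comp => //; exact: measurable_indic.
have ig : (mu \x nu)%E.-integrable setT (EFin \o g).
  apply: (@bounded_integrable _ _ _ _ g K) => // z; rewrite /g normrM !indicE.
  have K0 := le_trans (normr_ge0 _) (fK z).
  by do 2 case: (_ \in _); rewrite ?(normr1, mulr1, mulr0, normr0).
rewrite integral_mkcond [RHS]integral_mkcond.
transitivity (\int[(mu \x nu)%E]_z (EFin \o g) z)%E.
  apply: eq_integral => -[x y] _; rewrite patchE /g/= !indicE in_setX/=.
  by case: (x \in A) (y \in B) => -[]; rewrite /= ?(mulr1, mulr0).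
rewrite -integral21_prod_meas1//; apply: eq_integral => y _.
rewrite patchE /fubini_G /g; case: ifPn => yB.
  rewrite partial_integralE//; apply: eq_integral => x _.
  by rewrite /= [\1_B y]indicE yB mulr1 EFinM.
rewrite integral0_eq// => x _.
by rewrite /= [\1_B y]indicE (negbTE yB) !mulr0.
Qed.

(** By Fubini the integral of f over every rectangle vanishes. The null set in the hypothesis may
    depend on A. *)
Lemma partial_integral_eq0 :
  (forall A, measurable A -> {ae nu, forall y, partial_integral A f y = 0}) ->
  {ae (mu \x nu)%E, forall z, f z = 0}.
Proof.
move=> pf0; apply: integral_rectangles_eq0.
  exact: bounded_integrable mf fK.
move=> A B mA mB; rewrite integral_rectangle//.
rewrite (ae_eq_integral (cst 0%E))// ?integral0//.
  apply: measurable_funS (measurableT) _ _ => //.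
  by apply/measurable_EFinP; exact: measurable_partial_integral.
by apply: filterS (pf0 A mA) => y /= ->.
Qed.

End bounded.
End partial_integrals.

(** * Functions invariant under all shifts of the fibres *)

Section shift_invariant.
Context {R : realType} {d1 d2 : measure_display} {X : measurableType d1}
  {Y : measurableType d2} {G : topologicalZmodType}.
Variables (mu : probability X R) (nu : probability Y R).
Variables (T : X -> X) (phi : X -> G) (S : G -> Y -> Y).
Hypotheses (mT : measurable_fun setT T) (mphi : measurable_wrt measurable phi).
Hypothesis actS : measurable_action nu S.
Hypothesis ergTphiS : ergodic (mu \x nu)%E (skew_product T phi S).

Lemma partial_integral_shift (A : set X) (f g : X * Y -> R) (h : G) :
  measurable A -> measurable_fun setT f -> measurable_fun setT g ->
  {ae (mu \x nu)%E, forall z, f (fiber_shift S h z) = g z} ->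
  {ae nu, forall y, partial_integral mu A f (S h y) = partial_integral mu A g y}.
Proof.
move=> mA mf mg /ae_ysection; apply: filterS => y fg.
rewrite /partial_integral /Rintegral; congr fine; apply: ae_eq_integral => //.
- apply: measurable_funS measurableT _ _ => //; apply/measurable_EFinP.
  exact: (measurableT_comp mf (measurable_pair2 (S h y))).
- apply: measurable_funS measurableT _ _ => //; apply/measurable_EFinP.
  exact: (measurableT_comp mg (measurable_pair2 y)).
- by apply: filterS fg => x /= ->.
Qed.

Lemma action_constant_real (p : Y -> R) : measurable_fun setT p ->
  (forall h, {ae nu, forall y, p (S h y) = p y}) ->
  exists c, {ae nu, forall y, p y = c}.
Proof.
move=> mp invp.
have [||c pc] := action_constant actS mT mphi ergTphiS (p := fun y => (p y)%:C%C).
- by split => //; exact: measurable_cst.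
- by move=> h; apply: filterS (invp h) => y ->.
by exists (complex.Re c); apply: filterS pc => y <-.
Qed.

(** Take q to be the mean of f over the fibre and v = f - q. The averages of v over a set A of base
    points are invariant under the action, hence constant; the constant is the integral of v over A
    x Y, which is 0. The null sets belonging to different h never have to be combined. *)
Lemma shift_invariant_real (f : X * Y -> R) (K : R) : measurable_fun setT f ->
  (forall z, `|f z| <= K) ->
  (forall h, {ae (mu \x nu)%E, forall z, f (fiber_shift S h z) = f z}) ->
  exists2 q : X -> R, measurable_fun setT q &
    {ae (mu \x nu)%E, forall z, f z = q z.1}.
Proof.
move=> mf fK invf.
have ifx x : nu.-integrable setT (fun y => (f (x, y))%:E).
  by apply: (@bounded_integrable _ _ _ _ _ (fun y => f (x, y)) K) => //;
    exact: measurableT_comp.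
pose q x := (\int[nu]_y f (x, y))%R.
have qE x : (q x)%:E = (\int[nu]_y (f (x, y))%:E)%E.
  by rewrite /q /Rintegral fineK//; exact: integrable_fin_num (ifx x).
have mq : measurable_fun setT q.
  apply/measurable_EFinP.
  have := measurable_fubini_F (bounded_integrable (mu \x nu)%E measurableT mf fK).
  by congr measurable_fun; apply/funext => x; rewrite /= qE.
have qK x : `|q x| <= K.
  apply: le_trans (le_normr_Rintegral measurableT (ifx x)) _.
  apply: le_trans (_ : \int[nu]_y K <= _).
    apply: le_Rintegral => //; first exact: integrable_norm (ifx x).
    apply: (@bounded_integrable _ _ _ _ _ (fun=> K) `|K|) => //.
  by rewrite Rintegral_cst// [X in fine X](probability_setT nu) mulr1.
exists q => //.
pose v z := f z - q z.1.
have mv : measurable_fun setT v.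
  by apply: measurable_funB => //; exact: measurableT_comp.
have vK z : `|v z| <= K + K.
  by apply: le_trans (ler_normB _ _) _; apply: lerD.
suff : {ae (mu \x nu)%E, forall z, v z = 0}.
  by apply: filterS => z /eqP; rewrite subr_eq0 => /eqP.
apply: (partial_integral_eq0 mv vK) => A mA.
have [||k pk] := @action_constant_real (partial_integral mu A v).
- exact: (measurable_partial_integral mu nu mv vK mA).
- move=> h; apply: partial_integral_shift => //.
  by apply: filterS (invf h) => z; rewrite /v => ->.
suff k0 : k = 0 by apply: filterS pk => y ->.
have := integral_rectangle mu nu mv vK mA measurableT.
rewrite (ae_eq_integral (cst k%:E) (EFin \o partial_integral mu A v))//; last 2 first.
- by apply/measurable_EFinP; exact: (measurable_partial_integral mu nu mv vK mA).
- by apply: filterS pk => y /= ->.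
rewrite integral_cst// [X in (_ * X)%E](probability_setT nu) mule1 => vk.
(* Integrating over the fibre first gives 0, since q x is the mean of f (x, _). *)
suff v0 : (\int[(mu \x nu)%E]_(z in A `*` setT) (v z)%:E = 0)%E.
  by move: vk; rewrite v0 => -[].
pose g (z : X * Y) := v z * \1_A z.1.
have mg : measurable_fun setT g.
  apply: measurable_funM => //.
  by apply: measurableT_comp => //; exact: measurable_indic.
have ig : (mu \x nu)%E.-integrable setT (EFin \o g).
  apply: (@bounded_integrable _ _ _ _ _ g (K + K)) => // z; rewrite /g normrM indicE.
  by case: (_ \in _); rewrite ?normr1 ?mulr1// normr0 mulr0 (le_trans _ (vK z)).
rewrite integral_mkcond; transitivity (\int[(mu \x nu)%E]_z (EFin \o g) z)%E.
  apply: eq_integral => -[x y] _; rewrite patchE /g/= !indicE in_setX/=.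
  by case: (x \in A) => //=; rewrite ?in_setT ?mulr1 ?mulr0.
rewrite -integral12_prod_meas1// integral0_eq => //x _.
rewrite /fubini_F /g/=.
under eq_integral do rewrite EFinM muleC.
rewrite integralZl//; last first.
  by apply: (@bounded_integrable _ _ _ _ _ (fun y => v (x, y)) (K + K)) => //;
    exact: measurableT_comp.
under eq_integral do rewrite /v EFinB.
rewrite integralB//; last exact: (@bounded_integrable _ _ _ _ _ (fun=> q x) K).
have qx : (\int[nu]_y (q (x, y).1)%:E = (q x)%:E)%E.
  rewrite (integral_cst nu measurableT (q x)%:E).
  by rewrite [X in (_ * X)%E](probability_setT nu) mule1.
by rewrite -qE qx subee// mule0.
Qed.

End shift_invariant.

(** * Complex modulus and almost everywhere statements *)

Section modulus.
Context {R : realType}.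

Lemma normc_ge0 (z : R[i]) : 0 <= Normc.normc z.
Proof. by case: z => a b; exact: sqrtr_ge0. Qed.

Lemma mul_conj_normc (z : R[i]) : z * Num.conj z = (Normc.normc z ^+ 2)%:C%C.
Proof. by rewrite -normCK rmorphXn. Qed.

Lemma measurable_normc_sqr d (Z : measurableType d) (f : Z -> R[i]) :
  complex_measurable f -> measurable_fun setT (fun z => Normc.normc (f z) ^+ 2).
Proof.
move=> mf; have [+ _] := complex_measurableM mf (complex_measurable_conj mf).
by congr measurable_fun; apply/funext => z; rewrite mul_conj_normc.
Qed.

Lemma ae_and d (Z : measurableType d) (m : probability Z R) (P Q : Z -> Prop) :
  {ae m, forall z, P z} -> {ae m, forall z, Q z} -> {ae m, forall z, P z /\ Q z}.
Proof. exact: filterS2. Qed.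

Lemma not_ae d (Z : measurableType d) (m : probability Z R) (P Q : Z -> Prop) :
  {ae m, forall z, P z} -> ~ {ae m, forall z, Q z} -> exists2 z, P z & ~ Q z.
Proof.
move=> aeP naeQ; apply: contrapT => nPQ; apply: naeQ; apply: filterS aeP => z Pz.
by apply: contrapT => nQz; apply: nPQ; exists z.
Qed.

End modulus.

(** * Modulus and eigenvalue of an eigenfunction *)

Section eigenfunctions.
Context {R : realType} {d1 d2 : measure_display} {X : measurableType d1}
  {Y : measurableType d2} {G : topologicalZmodType}.
Variables (mu : probability X R) (nu : probability Y R).
Variables (T : X -> X) (phi : X -> G) (S : G -> Y -> Y).
Hypotheses (mT : measurable_fun setT T) (mphi : measurable_wrt measurable phi).
Hypothesis actS : measurable_action nu S.
Hypothesis ergTphiS : ergodic (mu \x nu)%E (skew_product T phi S).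
Hypothesis hG : hausdorff_space G.
Hypothesis lcG : locally_compact [set: G].

Lemma action_integral (g : G) (p : Y -> R) : measurable_fun setT p ->
  (forall y, 0 <= p y) ->
  (\int[nu]_y (p (S g y))%:E = \int[nu]_y (p y)%:E)%E.
Proof.
move=> mp p0; have mSg := action_measurable actS g.
transitivity (\int[pushforward nu (S g)]_y (p y)%:E)%E.
  rewrite (ge0_integral_pushforward mSg) ?preimage_setT//.
  - exact/measurable_EFinP.
  - by move=> y _; rewrite lee_fin.
apply: (@eq_measure_integral _ _ _ _ nu) => A mA _.
by have [/(_ g)[_ + _] _ _] := actS; apply.
Qed.

Section eigen.
Variables (F : Y -> R[i]) (chi : G -> R[i]).
Hypothesis mF : complex_measurable F.
Hypothesis F0 : ~ {ae nu, forall y, F y = 0}.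
Hypothesis eigenF : forall h, {ae nu, forall y, F (S h y) = chi h * F y}.

(** The homomorphism law of the action and the eigenvalue equations hold together at some point
    where F is nonzero, and F can be cancelled there. *)
Lemma eigenvalueD g h : chi (g + h) = chi g * chi h.
Proof.
have [_ SD _] := actS.
have H := ae_and (ae_and (SD g h) (eigenF (g + h)))
  (ae_and (eigenF h) (ae_action actS h (eigenF g))).
have [y [[/= e1 e2] [/= e3 e4]] /eqP Fy] := not_ae H F0.
by apply: (mulIf Fy); rewrite -e2 e1 e4 e3 mulrA.
Qed.

(** |F|^2 is invariant under the action, hence constant; the constant is positive as F is not almost
    everywhere zero. *)
Lemma eigenfunction_modulus : (forall h, `|chi h| = 1) ->
  exists2 r : R, 0 < r & {ae nu, forall y, F y * Num.conj (F y) = r%:C%C}.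
Proof.
move=> chi1.
have [||c Fc] := action_constant actS mT mphi ergTphiS
    (p := fun y => F y * Num.conj (F y)).
- by apply: complex_measurableM => //; exact: complex_measurable_conj.
- move=> h; apply: filterS (eigenF h) => y /= ->.
  by rewrite rmorphM mulrACA -normCK chi1 expr1n mul1r.
have [y /= Fyc Fy0] := not_ae Fc F0.
exists (Normc.normc (F y) ^+ 2); last first.
  by apply: filterS Fc => y' ->; rewrite -Fyc mul_conj_normc.
rewrite lt0r sqr_ge0 andbT sqrf_eq0; apply/eqP => /Normc.eq0_normc; exact: Fy0.
Qed.

Variable K : R.
Hypothesis FK : forall y, Normc.normc (F y) <= K.

(** As [S h] preserves nu, the integral of |F|^2 equals |chi h|^2 times itself, and it is finite and
    nonzero. *)
Lemma eigenvalue_unimodular h : `|chi h| = 1.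
Proof.
pose p y := Normc.normc (F y) ^+ 2.
have mp : measurable_fun setT p by exact: measurable_normc_sqr.
have p0 y : 0 <= p y by exact: sqr_ge0.
have pK y : `|p y| <= K ^+ 2.
  by rewrite ger0_norm// lerXn2r ?nnegrE ?(le_trans _ (FK y))// normc_ge0.
have ip : nu.-integrable setT (EFin \o p) := bounded_integrable nu measurableT mp pK.
have pp : {ae nu, forall y, p (S h y) = Normc.normc (chi h) ^+ 2 * p y}.
  by apply: filterS (eigenF h) => y Fy; rewrite /p Fy Normc.normcM exprMn.
have := action_integral h mp p0.
rewrite (ae_eq_integral (fun y => ((Normc.normc (chi h) ^+ 2)%:E * (p y)%:E)%E))//; last 3 first.
- apply/measurable_EFinP; exact: measurableT_comp mp (action_measurable actS h).
- by apply: measurable_funeM; exact/measurable_EFinP.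
- by apply: filterS pp => y /= ->; rewrite EFinM.
rewrite integralZl//.
have /fineK <- : (\int[nu]_y (p y)%:E)%E \is a fin_num by exact: integrable_fin_num ip.
set I := fine _ => -[Ieq].
have I0 : I != 0.
  apply/eqP => I0; apply: F0.
  have : (\int[nu]_y (p y)%:E = 0)%E.
    by rewrite -[LHS]fineK ?(integrable_fin_num _ ip)// -/I I0.
  move=> /ge0_integral_eq0_ae => /(_ _ _)/filterS; apply.
  - by move=> y [/eqP]; rewrite sqrf_eq0 => /eqP/Normc.eq0_normc.
  - exact/measurable_EFinP.
  - by move=> y; rewrite lee_fin.
have /eqP := mulIf I0 (etrans Ieq (esym (mul1r I))).
rewrite sqrf_eq1 => /orP[/eqP e|/eqP e]; first by rewrite normc_def; case: (chi h) e => a b /= ->.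
by have := normc_ge0 (chi h); rewrite e oppr_ge0 ler10.
Qed.

End eigen.
End eigenfunctions.

(** * Measurability and continuity of eigenvalues *)

Section eigenvalue_continuity.
Context {R : realType} {d1 d2 : measure_display} {X : measurableType d1}
  {Y : measurableType d2} {G : topologicalZmodType}.
Variables (mu : probability X R) (nu : probability Y R).
Variables (T : X -> X) (phi : X -> G) (S : G -> Y -> Y).
Hypotheses (mT : measurable_fun setT T) (mphi : measurable_wrt measurable phi).
Hypothesis actS : measurable_action nu S.
Hypothesis ergTphiS : ergodic (mu \x nu)%E (skew_product T phi S).
Hypothesis hG : hausdorff_space G.
Hypothesis lcG : locally_compact [set: G].

Lemma normc_conj (z : R[i]) : Normc.normc (Num.conj z) = Normc.normc z.
Proof. by case: z => a b /=; rewrite sqrrN. Qed.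

Lemma Rintegral_ae_cst (p : Y -> R) (c : R) : measurable_fun setT p ->
  {ae nu, forall y, p y = c} -> \int[nu]_y p y = c.
Proof.
move=> mp pc; rewrite /Rintegral (ae_eq_integral (cst c%:E))//.
- by rewrite integral_cst// [X in (_ * X)%E](probability_setT nu) mule1.
- exact/measurable_EFinP.
- by apply: filterS pc => y /= ->.
Qed.

(** The parameter space carries no measure, so the Tonelli measurability statement is applied to the
    nonnegative function w + K, and K is subtracted afterwards. *)
Lemma measurable_Rintegral_parameter d (Z : measurableType d) (w : Z * Y -> R)
    (K : R) : measurable_fun setT w -> (forall p, `|w p| <= K) ->
  measurable_fun setT (fun z => \int[nu]_y w (z, y)).
Proof.
move=> mw wK; have iw z : nu.-integrable setT (fun y => (w (z, y))%:E).
  by apply: (@bounded_integrable _ _ _ _ _ (fun y => w (z, y)) K) => //;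
    exact: measurableT_comp.
have mwK : measurable_fun setT (fun p => (w p + K)%:E).
  by apply/measurable_EFinP; exact: measurable_funD.
have w0 p : (0 <= (w p + K)%:E)%E.
  by rewrite lee_fin -lerBlDr sub0r; have := wK p; rewrite ler_norml => /andP[].
have := measurable_fun_fubini_tonelli_F (m2 := nu) _ mwK w0.
move=> /(measurableT_comp (fine_measurable measurableT)) m1.
have := measurable_funB m1 (measurable_cst K).
congr measurable_fun; apply/funext => z /=; rewrite /fubini_F.
under eq_integral do rewrite EFinD.
rewrite integralD//; last by apply: (@bounded_integrable _ _ _ _ _ (fun=> K) `|K|).
rewrite (integral_cst nu measurableT K%:E) [X in (_ + _ * X)%E](probability_setT nu) mule1.
by rewrite fineD//= ?addrK//; exact: integrable_fin_num (iw z).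
Qed.

Variables (F : Y -> R[i]) (chi : G -> R[i]) (K : R).
Hypothesis mF : complex_measurable F.
Hypothesis F0 : ~ {ae nu, forall y, F y = 0}.
Hypothesis eigenF : forall h, {ae nu, forall y, F (S h y) = chi h * F y}.
Hypothesis FK : forall y, Normc.normc (F y) <= K.

(** With |F|^2 = r almost everywhere, r chi(h) is the integral of F (S_h y) conj(F y) over y, which
    depends measurably on h. *)
Lemma eigenvalue_measurable : @complex_measurable R _ (borel_group G) chi.
Proof.
have chi1 := eigenvalue_unimodular actS mF F0 eigenF FK.
have [r r0 Fr] := eigenfunction_modulus mT mphi actS ergTphiS mF F0 eigenF chi1.
pose w (p : borel_group G * Y) := F (S p.1 p.2) * Num.conj (F p.2).
have mS : measurable_fun setT (fun p : borel_group G * Y => S p.1 p.2).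
  by move=> _ A mA; rewrite setTI; exact: (action_curry_measurable actS).
have mw : complex_measurable w.
  apply: complex_measurableM; first exact: complex_measurable_comp mF mS.
  by apply: complex_measurable_conj; apply: complex_measurable_comp mF _; exact: measurable_snd.
have wK p : Normc.normc (w p) <= K * K.
  by rewrite Normc.normcM normc_conj ler_pM ?normc_ge0.
have wE h : {ae nu, forall y, w (h, y) = chi h * r%:C%C}.
  by apply: filterS2 (eigenF h) Fr => y Fh Fy; rewrite /w/= Fh -mulrA Fy.
have mwh h : complex_measurable (fun y => w (h, y)).
  by apply: complex_measurable_comp mw _; exact: measurable_pair1.
have rn0 : r != 0 by rewrite gt_eqF.
split.
- have := measurable_Rintegral_parameter mw.1 (fun p => le_trans (normc_geRe _) (wK p)).
  move=> /(measurable_funM (measurable_cst r^-1)).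
  congr measurable_fun; apply/funext => h /=.
  rewrite (Rintegral_ae_cst (c := complex.Re (chi h) * r) (mwh h).1) ?mulKf//.
    by rewrite mulrCA mulVf// mulr1.
  by apply: filterS (wE h) => y ->; case: (chi h) => a b /=; rewrite mulr0 subr0.
- have := measurable_Rintegral_parameter mw.2 (fun p => le_trans (normc_geIm _) (wK p)).
  move=> /(measurable_funM (measurable_cst r^-1)).
  congr measurable_fun; apply/funext => h /=.
  rewrite (Rintegral_ae_cst (c := complex.Im (chi h) * r) (mwh h).2) ?mulKf//.
    by rewrite mulrCA mulVf// mulr1.
  by apply: filterS (wE h) => y ->; case: (chi h) => a b /=; rewrite mulr0 add0r.
Qed.

(** No continuity of chi is assumed: chi is a Borel homomorphism to the unit circle, hence a
    continuous character. *)
Lemma bounded_eigenfunction : eigenfunction nu S F.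
Proof.
have chi1 := eigenvalue_unimodular actS mF F0 eigenF FK.
have chiD := eigenvalueD actS F0 eigenF.
split => //.
  split; first exact/measurable_wrtE.
  have : nu.-integrable setT (EFin \o (fun y => Normc.normc (F y) ^+ 2)).
    apply: (@bounded_integrable _ _ _ _ _ _ (K ^+ 2)) => //.
      exact: measurable_normc_sqr.
    move=> y; rewrite ger0_norm ?sqr_ge0// lerXn2r ?nnegrE ?normc_ge0//.
    by rewrite (le_trans _ (FK y))// normc_ge0.
  move=> /integrableP[_]; congr (_ < _)%E; apply: eq_integral => y _.
  by rewrite /= ger0_norm ?sqr_ge0.
exists chi => //; split => //.
apply: measurable_character_continuous => // O oO.
exact: ((measurable_wrtE _).2 eigenvalue_measurable O oO).
Qed.

End eigenvalue_continuity.

(** * Splitting a function that is an eigenvector of all shifts *)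

Section decomposition.
Context {R : realType} {d1 d2 : measure_display} {X : measurableType d1}
  {Y : measurableType d2} {G : topologicalZmodType}.
Variables (mu : probability X R) (nu : probability Y R).
Variables (T : X -> X) (phi : X -> G) (S : G -> Y -> Y).
Hypotheses (mT : measurable_fun setT T) (mphi : measurable_wrt measurable phi).
Hypothesis actS : measurable_action nu S.
Hypothesis ergTphiS : ergodic (mu \x nu)%E (skew_product T phi S).
Hypothesis hG : hausdorff_space G.
Hypothesis lcG : locally_compact [set: G].

Lemma ae_of_snd (Q : Y -> Prop) : {ae nu, forall y, Q y} ->
  {ae (mu \x nu)%E, forall z, Q z.2}.
Proof.
move=> [N [mN N0 QN]].
have : {ae (mu \x nu)%E, forall z : X * Y, (~` N) z.2}.
  apply: xsection_ae; last first.
    by apply: aeW => x; exists N; split => // y /=; exact: contrapT.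
  rewrite (_ : [set _ | _] = setT `&` snd @^-1` (~` N)); last by rewrite setTI.
  by apply: measurable_snd => //; exact: measurableC.
by apply: filterS => z nN; apply: contrapT => /QN.
Qed.

Lemma shift_invariant_complex (f : X * Y -> R[i]) (K : R) : complex_measurable f ->
  (forall z, Normc.normc (f z) <= K) ->
  (forall h, {ae (mu \x nu)%E, forall z, f (fiber_shift S h z) = f z}) ->
  exists2 q : X -> R[i], complex_measurable q &
    {ae (mu \x nu)%E, forall z, f z = q z.1}.
Proof.
move=> [f1 f2] fK invf.
have [||q1 mq1 fq1] := shift_invariant_real mT mphi actS ergTphiS (K := K) f1.
- by move=> z; exact: le_trans (normc_geRe _) (fK z).
- by move=> h; apply: filterS (invf h) => z ->.
have [||q2 mq2 fq2] := shift_invariant_real mT mphi actS ergTphiS (K := K) f2.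
- by move=> z; exact: le_trans (normc_geIm _) (fK z).
- by move=> h; apply: filterS (invf h) => z ->.
exists (fun x => (q1 x +i* q2 x)%C) => //.
by apply: filterS2 fq1 fq2 => z; case: (f z) => a b /= -> ->.
Qed.

Definition complex_partial_integral (A : set X) (f : X * Y -> R[i]) (y : Y) : R[i] :=
  (partial_integral mu A (fun z => complex.Re (f z)) y +i*
   partial_integral mu A (fun z => complex.Im (f z)) y)%C.

(* Averaging over x is what makes the eigenvalue equation hold for every h: for
   a single section f (x, _) the null set of bad x would depend on h. *)
Lemma complex_partial_integral_shift (A : set X) (f : X * Y -> R[i]) (K : R)
    (h : G) (c : R[i]) : measurable A -> complex_measurable f ->
  (forall z, Normc.normc (f z) <= K) ->
  {ae (mu \x nu)%E, forall z, f (fiber_shift S h z) = c * f z} ->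
  {ae nu, forall y, complex_partial_integral A f (S h y) =
    c * complex_partial_integral A f y}.
Proof.
move=> mA mf fK fc.
have [cf1 cf2] := complex_measurableM (complex_measurable_cst (X * Y)%type c) mf.
have uK z : `|complex.Re (f z)| <= K by exact: le_trans (normc_geRe _) (fK z).
have vK z : `|complex.Im (f z)| <= K by exact: le_trans (normc_geIm _) (fK z).
have fu : {ae (mu \x nu)%E, forall z,
    complex.Re (f (fiber_shift S h z)) = complex.Re (c * f z)}.
  by apply: filterS fc => z ->.
have fv : {ae (mu \x nu)%E, forall z,
    complex.Im (f (fiber_shift S h z)) = complex.Im (c * f z)}.
  by apply: filterS fc => z ->.
have Hu := partial_integral_shift mA mf.1 cf1 fu.
have Hv := partial_integral_shift mA mf.2 cf2 fv.
have iu y := partial_integrable mu mf.1 uK y mA.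
have iv y := partial_integrable mu mf.2 vK y mA.
apply: filterS2 Hu Hv => y; rewrite /complex_partial_integral => -> ->.
case: c {fc cf1 cf2 fu fv} => a b; rewrite /partial_integral.
have iZ (k : R) (u : X -> R) : mu.-integrable A (EFin \o u) ->
    mu.-integrable A (EFin \o (fun x => k * u x)).
  by move=> iu'; have := integrableZl mA k iu'; apply: eq_integrable => // x _; rewrite /= EFinM.
set u := fun z => complex.Re (f z); set v := fun z => complex.Im (f z).
transitivity ((a * \int[mu]_(x in A) u (x, y) - b * \int[mu]_(x in A) v (x, y)) +i*
  (a * \int[mu]_(x in A) v (x, y) + b * \int[mu]_(x in A) u (x, y)))%C; last by [].
congr (_ +i* _)%C.
- rewrite -(RintegralZl a mA (iu y)) -(RintegralZl b mA (iv y)) -RintegralB;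
    [|exact: mA|exact: (iZ a _ (iu y))|exact: (iZ b _ (iv y))].
  by apply: eq_Rintegral => x _; rewrite /u /v; case: (f (x, y)).
- rewrite -(RintegralZl a mA (iv y)) -(RintegralZl b mA (iu y)) -RintegralD;
    [|exact: mA|exact: (iZ a _ (iv y))|exact: (iZ b _ (iu y))].
  by apply: eq_Rintegral => x _; rewrite /u /v; case: (f (x, y)).
Qed.

Lemma shift_eigen_decomposition (f : X * Y -> R[i]) (chi : G -> R[i]) (K : R) :
  complex_measurable f -> (forall z, Normc.normc (f z) <= K) ->
  (forall h, {ae (mu \x nu)%E, forall z, f (fiber_shift S h z) = chi h * f z}) ->
  exists (q : X -> R[i]) (F : Y -> R[i]),
    [/\ complex_measurable q, eigenfunction nu S F &
        {ae (mu \x nu)%E, forall z, f z = q z.1 * F z.2}].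
Proof.
move=> mf fK eigf.
have uK z : `|complex.Re (f z)| <= K by exact: le_trans (normc_geRe _) (fK z).
have vK z : `|complex.Im (f z)| <= K by exact: le_trans (normc_geIm _) (fK z).
(* If all averages of f over sets of base points vanished, f would vanish almost everywhere by
   [partial_integral_eq0]. *)
have [A mA FA0] : exists2 A, measurable A &
    ~ {ae nu, forall y, complex_partial_integral A f y = 0} \/
    {ae (mu \x nu)%E, forall z, f z = 0}.
  have [f0|] := pselect {ae (mu \x nu)%E, forall z, f z = 0}.
    by exists setT => //; right.
  move=> nf0; apply: contrapT => nA; apply: nf0.
  have pA A : measurable A -> {ae nu, forall y, complex_partial_integral A f y = 0}.
    by move=> mA; apply: contrapT => nA0; apply: nA; exists A => //; left.
  have u0 : {ae (mu \x nu)%E, forall z, complex.Re (f z) = 0}.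
    by apply: (partial_integral_eq0 mf.1 uK) => A mA; apply: filterS (pA A mA) => y [].
  have v0 : {ae (mu \x nu)%E, forall z, complex.Im (f z) = 0}.
    by apply: (partial_integral_eq0 mf.2 vK) => A mA; apply: filterS (pA A mA) => y [].
  by apply: filterS2 u0 v0 => z; case: (f z) => a b /= -> ->.
have [f0|nf0] := pselect {ae (mu \x nu)%E, forall z, f z = 0}.
  (* An eigenfunction must not vanish, so the zero function is written as 0 times the constant
     eigenfunction 1. *)
  exists (fun=> 0), (fun=> 1); split; first exact: complex_measurable_cst.
    apply: (bounded_eigenfunction mT mphi actS ergTphiS hG lcG (chi := fun=> 1) (K := 1)).
    - exact: complex_measurable_cst.
    - by move=> /ae_nonempty[_ /eqP]; rewrite oner_eq0.
    - by move=> h; apply: aeW => y; rewrite mul1r.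
    - by move=> y; rewrite Normc.normc1.
  by apply: filterS f0 => z ->; rewrite mul0r.
case: FA0 => // FA0.
pose F := complex_partial_integral A f.
have mF : complex_measurable F.
  by split; [exact: (measurable_partial_integral mu nu mf.1 uK mA)|
    exact: (measurable_partial_integral mu nu mf.2 vK mA)].
have FK y : Normc.normc (F y) <= K + K.
  apply: le_trans (normc_leReIm _) _; apply: lerD.
    exact: (normr_partial_integral mu mf.1 uK y mA).
  exact: (normr_partial_integral mu mf.2 vK y mA).
have eigF h : {ae nu, forall y, F (S h y) = chi h * F y}.
  exact: complex_partial_integral_shift mA mf fK (eigf h).
have chi1 := eigenvalue_unimodular actS mF FA0 eigF FK.
have [r r0 Fr] := eigenfunction_modulus mT mphi actS ergTphiS mF FA0 eigF chi1.
have mF2 : complex_measurable (fun z : X * Y => F z.2).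
  by apply: complex_measurable_comp mF _; exact: measurable_snd.
have [|||p mp fp] := @shift_invariant_complex
    (fun z => f z * Num.conj (F z.2)) (K * (K + K)).
- by apply: complex_measurableM => //; exact: complex_measurable_conj.
- by move=> z; rewrite Normc.normcM normc_conj ler_pM ?normc_ge0.
- move=> h; apply: filterS2 (eigf h) (ae_of_snd (eigF h)) => z /= -> ->.
  by rewrite rmorphM mulrACA -normCK chi1 expr1n mul1r.
(* From f conj(F) = p and |F|^2 = r follows f = (p / r) F. *)
exists (fun x => (r^-1)%:C%C * p x), F; split.
- by apply: complex_measurableM => //; exact: complex_measurable_cst.
- exact: (bounded_eigenfunction mT mphi actS ergTphiS hG lcG mF FA0 eigF FK).
- apply: filterS2 fp (ae_of_snd Fr) => z fz Fz.
  rewrite -fz -mulrA -mulrA [Num.conj _ * _]mulrC Fz mulrCA -rmorphM/=.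
  by rewrite mulVf ?gt_eqF// mulr1.
Qed.

End decomposition.

(** * Sections of a unitary cocycle *)

Section relative_sections.
Local Open Scope sesquilinear_scope.
Context {R : realType} {d1 d2 : measure_display} {X : measurableType d1}
  {Y : measurableType d2} {G : topologicalZmodType}.
Variables (mu : probability X R) (nu : probability Y R).
Variables (T : X -> X) (phi : X -> G) (S : G -> Y -> Y).
Hypotheses (mT : measurable_fun setT T) (mphi : measurable_wrt measurable phi).
Hypothesis actS : measurable_action nu S.
Hypothesis ergTphiS : ergodic (mu \x nu)%E (skew_product T phi S).

Variables (n : nat) (c : X * Y -> 'M[R[i]]_n).
Hypothesis unitary_c : forall z, c z \is unitarymx.
Hypothesis c_fst : forall z z' : X * Y, z.1 = z'.1 -> c z = c z'.

Local Notation tau := (skew_product T phi S).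
Local Notation shift := (fiber_shift S).

(** The rows are transposed relative eigenfunctions: the cocycle acts on the right, which leaves the
    left side free for constant matrices. *)
Definition relative_section r (W : X * Y -> 'M[R[i]]_(r, n)) :=
  (forall i j, complex_measurable (fun z => W z i j)) /\
  {ae (mu \x nu)%E, forall z, W (tau z) = W z *m (c z)^T}.

Definition ae_orthonormal r (W : X * Y -> 'M[R[i]]_(r, n)) :=
  {ae (mu \x nu)%E, forall z, W z *m (W z)^t* = 1%:M}.

Lemma ae_all (I : finType) (Q : I -> X * Y -> Prop) :
  (forall i, {ae (mu \x nu)%E, forall z, Q i z}) ->
  {ae (mu \x nu)%E, forall z, forall i, Q i z}.
Proof. by move=> QP; apply: filter_forall. Qed.

(* The unitary cocycle cancels in W U^*, which is thus invariant. *)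
Lemma relative_section_gram r s (W : X * Y -> 'M[R[i]]_(r, n))
    (U : X * Y -> 'M[R[i]]_(s, n)) : relative_section W -> relative_section U ->
  exists K : 'M[R[i]]_(r, s), {ae (mu \x nu)%E, forall z, W z *m (U z)^t* = K}.
Proof.
move=> [mW invW] [mU invU].
have inv : {ae (mu \x nu)%E, forall z,
    W (tau z) *m (U (tau z))^t* = W z *m (U z)^t*}.
  apply: filterS2 invW invU => z -> ->.
  rewrite trmx_mul map_mxM mulmxA -[W z *m _ *m _]mulmxA.
  have : (c z)^T \is unitarymx by rewrite trmx_unitary.
  by move=> /unitarymxP ->; rewrite mulmx1.
have H ij : exists k, {ae (mu \x nu)%E, forall z, (W z *m (U z)^t*) ij.1 ij.2 = k}.
  apply: (ergodic_constant (skew_product_measurable actS mT mphi) ergTphiS).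
    under eq_fun do rewrite mxE.
    apply: complex_measurable_sum => k; under eq_fun do rewrite !mxE.
    by apply: complex_measurableM => //; exact: complex_measurable_conj.
  by apply: filterS inv => z ->.
have [k kP] := choice H.
exists (\matrix_(i, j) k (i, j)); apply: filterS (ae_all kP) => z zP.
by apply/matrixP => i j; rewrite [RHS]mxE -(zP (i, j)).
Qed.

(** The shift commutes with the skew product almost everywhere and fixes x, hence fixes the
    cocycle. *)
Lemma relative_section_shift r (W : X * Y -> 'M[R[i]]_(r, n)) h :
  relative_section W -> relative_section (fun z => W (shift h z)).
Proof.
move=> [mW invW]; split=> [i j|].
  exact: complex_measurable_comp (mW i j) (fiber_shift_measurable actS h).
have H := ae_all (fun ij : 'I_r * 'I_n =>
  fiber_shift_skew_comm mu actS mT mphi h (mW ij.1 ij.2)).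
apply: filterS2 H (ae_fiber_shift actS h invW) => z Hz Wz.
rewrite -(@c_fst (shift h z) z)// -Wz.
by apply/matrixP => i j; exact: (Hz (i, j)).
Qed.

Lemma relative_section_mull r s (K : 'M[R[i]]_(s, r)) (W : X * Y -> 'M[R[i]]_(r, n)) :
  relative_section W -> relative_section (fun z => K *m W z).
Proof.
move=> [mW invW]; split=> [i j|]; last by apply: filterS invW => z ->; rewrite mulmxA.
under eq_fun do rewrite mxE; apply: complex_measurable_sum => k.
by apply: complex_measurableM => //; exact: complex_measurable_cst.
Qed.

Lemma relative_sectionD r (W U : X * Y -> 'M[R[i]]_(r, n)) :
  relative_section W -> relative_section U ->
  relative_section (fun z => W z + U z).
Proof.
move=> [mW invW] [mU invU]; split=> [i j|]; last first.
  by apply: filterS2 invW invU => z -> ->; rewrite mulmxDl.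
by under eq_fun do rewrite mxE; exact: complex_measurableD.
Qed.

Lemma relative_section_col_mx r s (W : X * Y -> 'M[R[i]]_(r, n))
    (U : X * Y -> 'M[R[i]]_(s, n)) : relative_section W -> relative_section U ->
  relative_section (fun z => col_mx (W z) (U z)).
Proof.
move=> [mW invW] [mU invU]; split=> [i j|]; last first.
  by apply: filterS2 invW invU => z -> ->; rewrite mul_col_mx.
by under eq_fun do rewrite mxE; case: (fintype.split i) => k.
Qed.

Lemma ae_orthonormal_leq r (W : X * Y -> 'M[R[i]]_(r, n)) :
  ae_orthonormal W -> (r <= n)%N.
Proof.
move=> /ae_nonempty[z /eqP Wz].
by rewrite -(mxrank_unitary (M := W z))// rank_leq_col.
Qed.

Lemma maximal_orthonormal_section : exists r (W : X * Y -> 'M[R[i]]_(r, n)),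
  [/\ relative_section W, ae_orthonormal W &
    forall W' : X * Y -> 'M[R[i]]_(r + 1, n),
      relative_section W' -> ~ ae_orthonormal W'].
Proof.
pose p r := `[< exists W : X * Y -> 'M[R[i]]_(r, n),
  relative_section W /\ ae_orthonormal W >].
have p0 : exists r, p r.
  exists 0%N; apply/asboolP; exists (fun=> 0); split.
    by split=> [|]; [case|apply: aeW => z; rewrite mul0mx].
  by apply: aeW => z; apply/matrixP; case.
have pn r : p r -> (r <= n)%N by move=> /asboolP[W [_ /ae_orthonormal_leq]].
case: (ex_maxnP p0 pn) => r /asboolP[W [sW oW]] maxr.
exists r, W; split => // W' sW' oW'.
have /maxr : p (r + 1)%N by apply/asboolP; exists W'.
by rewrite addn1 ltnn.
Qed.

Lemma relative_section_row r (W : X * Y -> 'M[R[i]]_(r, n)) i :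
  relative_section W -> relative_section (fun z => row i (W z)).
Proof.
move=> [mW invW]; split=> [k j|]; last by apply: filterS invW => z ->; rewrite row_mul.
by under eq_fun do rewrite mxE.
Qed.

Lemma mulmx_adjE (u : 'rV[R[i]]_n) : (u *m u ^t*) 0 0 = \sum_j `|u 0 j| ^+ 2.
Proof. by rewrite mxE; apply: eq_bigr => j _; rewrite !mxE -normCK. Qed.

Lemma mulmx_adj_ge0 (u : 'rV[R[i]]_n) : 0 <= (u *m u ^t*) 0 0.
Proof. by rewrite mulmx_adjE sumr_ge0// => j _; rewrite exprn_ge0. Qed.

Lemma mulmx_adj_eq0 (u : 'rV[R[i]]_n) : (u *m u ^t*) 0 0 = 0 -> u = 0.
Proof.
rewrite mulmx_adjE => /psumr_eq0P u0; apply/rowP => j; rewrite mxE.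
have /eqP : `|u 0 j| ^+ 2 = 0 by apply: u0 => // k _; rewrite exprn_ge0.
by rewrite expf_eq0/= normr_eq0 => /eqP.
Qed.

Section spanning.
Variables (r : nat) (W : X * Y -> 'M[R[i]]_(r, n)).
Hypotheses (sW : relative_section W) (oW : ae_orthonormal W).
Hypothesis maxW : forall W' : X * Y -> 'M[R[i]]_(r + 1, n),
  relative_section W' -> ~ ae_orthonormal W'.

(** A Gram-Schmidt step: with the constant K = U W^*, the remainder E = U - K W is a section
    orthogonal to W of constant norm. Were that norm nonzero, the normalized E could be added to W
    as a new row, against maximality. *)
Lemma maximal_span_row (U : X * Y -> 'rV[R[i]]_n) : relative_section U ->
  exists K : 'rV[R[i]]_r, {ae (mu \x nu)%E, forall z, U z = K *m W z}.
Proof.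
move=> sU; have [K KP] := relative_section_gram sU sW; exists K.
pose E z := U z + (- K) *m W z.
have sE : relative_section E.
  by apply: relative_sectionD => //; exact: relative_section_mull.
have EW : {ae (mu \x nu)%E, forall z, E z *m (W z)^t* = 0}.
  apply: filterS2 KP oW => z Kz Wz.
  by rewrite mulmxDl Kz mulNmx mulNmx -mulmxA Wz mulmx1 subrr.
have [e eP] := relative_section_gram sE sE.
have [z0 ez0] := ae_nonempty eP.
suff e0 : e = 0.
  apply: filterS eP => z; rewrite e0 => Ez.
  have /mulmx_adj_eq0/eqP : (E z *m (E z)^t*) 0 0 = 0 by rewrite Ez mxE.
  by rewrite /E mulNmx subr_eq0 => /eqP.
apply/eqP/negPn/negP => e0.
have e00 : 0 < e 0 0.
  rewrite -ez0 lt_def mulmx_adj_ge0 andbT; apply: contra e0.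
  by rewrite -ez0 => /eqP/mulmx_adj_eq0 ->; rewrite mul0mx.
(* The scalar s is the inverse of the norm of E, whose constant square is e 0 0. *)
pose s : R[i] := (sqrtC (e 0 0))^-1.
have s0 : 0 <= s by rewrite invr_ge0 sqrtC_ge0 ltW.
have sse : s * s * e 0 0 = 1.
  by rewrite -expr2 exprVn sqrtCK mulVf// gt_eqF.
apply: (maxW (W' := fun z => col_mx (W z) (s%:M *m E z))).
  by apply: relative_section_col_mx => //; exact: relative_section_mull.
apply: filterS2 (filterI EW oW) eP => z [EWz oWz] Ez.
rewrite tr_col_mx map_row_mx mul_col_row oWz trmx_mul map_mxM mulmxA.
have WE : W z *m (E z)^t* = 0.
  by rewrite -[LHS]trmxCK trmx_mul map_mxM trmxCK EWz trmx0 map_mx0.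
rewrite WE mul0mx -mulmxA EWz mulmx0.
rewrite (scalar_mx_block r 1); congr block_mx.
rewrite !mulmxA -[_ *m E z *m _]mulmxA Ez.
rewrite (mx11_scalar e) tr_scalar_mx map_scalar_mx -!scalar_mxM.
have sr : Num.conj s = s by apply: CrealP; exact: ger0_real.
by rewrite [X in _ * X]sr mulrAC sse.
Qed.

Lemma maximal_span k (U : X * Y -> 'M[R[i]]_(k, n)) : relative_section U ->
  exists K : 'M[R[i]]_(k, r), {ae (mu \x nu)%E, forall z, U z = K *m W z}.
Proof.
move=> sU; have H i := maximal_span_row (relative_section_row i sU).
have [K KP] := choice H.
exists (\matrix_i K i); apply: filterS (ae_all KP) => z zP.
by apply/row_matrixP => i; rewrite zP row_mul rowK.
Qed.

Lemma ae_orthonormal_inj k (K L : 'M[R[i]]_(k, r)) :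
  {ae (mu \x nu)%E, forall z, K *m W z = L *m W z} -> K = L.
Proof.
move=> KL; have [z [/= e1 e2]] := ae_nonempty (ae_and KL oW).
by rewrite -[K]mulmx1 -[L]mulmx1 -e2 !mulmxA e1.
Qed.

End spanning.

End relative_sections.

(** * Diagonalization of the shifts and decomposition of relative sections *)

Section relative_decomposition.
Local Open Scope sesquilinear_scope.
Context {R : realType} {d1 d2 : measure_display} {X : measurableType d1}
  {Y : measurableType d2} {G : topologicalZmodType}.
Variables (mu : probability X R) (nu : probability Y R).
Variables (T : X -> X) (phi : X -> G) (S : G -> Y -> Y).
Hypotheses (mT : measurable_fun setT T) (mphi : measurable_wrt measurable phi).
Hypothesis actS : measurable_action nu S.
Hypothesis ergTphiS : ergodic (mu \x nu)%E (skew_product T phi S).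
Hypothesis hG : hausdorff_space G.
Hypothesis lcG : locally_compact [set: G].

Lemma orthonormal_entry_le1 m n (A : 'M[R[i]]_(m, n)) i j :
  A *m A ^t* = 1%:M -> Normc.normc (A i j) ^+ 2 <= 1.
Proof.
move=> AA; rewrite -lecR -mul_conj_normc -normCK.
have -> : 1%:C%C = \sum_k `|A i k| ^+ 2.
  transitivity ((A *m A ^t*) i i); first by rewrite AA mxE eqxx.
  by rewrite mxE; apply: eq_bigr => k _; rewrite !mxE -normCK.
by rewrite (bigD1 j)//= lerDl sumr_ge0// => k _; rewrite exprn_ge0.
Qed.

(** Setting f to 0 on the null set where |f| > 1 makes the bound hold everywhere; the eigenvalue
    equations survive because shifts preserve null sets. *)
Lemma ae_bounded_shift_eigen_decomposition (f : X * Y -> R[i]) (chi : G -> R[i]) :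
  complex_measurable f ->
  {ae (mu \x nu)%E, forall z, Normc.normc (f z) ^+ 2 <= 1} ->
  (forall h, {ae (mu \x nu)%E, forall z, f (fiber_shift S h z) = chi h * f z}) ->
  exists (q : X -> R[i]) (F : Y -> R[i]),
    [/\ complex_measurable q, eigenfunction nu S F &
        {ae (mu \x nu)%E, forall z, f z = q z.1 * F z.2}].
Proof.
move=> mf f1 eigf.
pose A := [set z | Normc.normc (f z) ^+ 2 <= 1].
have mA : measurable A.
  rewrite (_ : A = (fun z => Normc.normc (f z) ^+ 2) @^-1` `]-oo, 1]%classic).
    by rewrite -[X in measurable X]setTI; apply: (measurable_normc_sqr mf).
  by apply/seteqP; split => z; rewrite /= in_itv.
pose g z := f z * (\1_A z)%:C%C.
have fg : {ae (mu \x nu)%E, forall z, g z = f z}.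
  by apply: filterS f1 => z z1; rewrite /g indicE mem_set// mulr1.
have mg : complex_measurable g.
  apply: complex_measurableM => //; split; last exact: measurable_cst.
  exact: measurable_indic.
have g1 z : Normc.normc (g z) <= 1.
  rewrite /g indicE; have [/set_mem zA|_] := boolP (z \in A).
    by rewrite mulr1 -(@expr_le1 _ 2)// normc_ge0.
  by rewrite mulr0 Normc.normc0.
have eigg h : {ae (mu \x nu)%E, forall z, g (fiber_shift S h z) = chi h * g z}.
  apply: filterS2 (ae_and fg (ae_fiber_shift actS h fg)) (eigf h).
  by move=> z [-> ->].
have [q [F [mq eF gqF]]] :=
  shift_eigen_decomposition mT mphi actS ergTphiS hG lcG mg g1 eigg.
by exists q, F; split => //; apply: filterS2 fg gqF => z <-.
Qed.

Variables (n : nat) (c : X * Y -> 'M[R[i]]_n).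
Hypothesis unitary_c : forall z, c z \is unitarymx.
Hypothesis c_fst : forall z z' : X * Y, z.1 = z'.1 -> c z = c z'.

Local Notation tau := (skew_product T phi S).
Local Notation shift := (fiber_shift S).
Local Notation relative_section := (relative_section mu nu T phi S c).

Lemma fiber_shiftD g h :
  {ae (mu \x nu)%E, forall z, shift (g + h) z = shift g (shift h z)}.
Proof.
have [_ SD _] := actS.
by apply: filterS (ae_of_snd mu (SD g h)) => -[x y]; rewrite /fiber_shift /= => ->.
Qed.

(** Since the coefficients in W are unique, the matrices B(h) with W o S_h = B(h) W form a unitary
    representation of G. They commute, and B(- h) is the adjoint of B(h), so one unitary P
    diagonalizes them all; the section sought is P W. *)
Lemma diagonal_section : exists r (W : X * Y -> 'M[R[i]]_(r, n)) (D : G -> 'M[R[i]]_r),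
  [/\ relative_section W, ae_orthonormal mu nu W,
    forall k (U : X * Y -> 'M[R[i]]_(k, n)), relative_section U ->
      exists K : 'M[R[i]]_(k, r), {ae (mu \x nu)%E, forall z, U z = K *m W z},
    forall h, is_diag_mx (D h) &
    forall h, {ae (mu \x nu)%E, forall z, W (shift h z) = D h *m W z}].
Proof.
have [r [W [sW oW maxW]]] := maximal_orthonormal_section mu nu T phi S c.
have spanW k (U : X * Y -> 'M[R[i]]_(k, n)) :=
  @maximal_span _ _ _ _ _ _ mu nu T phi S mT mphi actS ergTphiS n c unitary_c r W sW oW maxW k U.
have [B BP] := choice (fun h => spanW _ _ (relative_section_shift mT mphi actS c_fst h sW)).
have injW := ae_orthonormal_inj oW.
have BD g h : B (g + h) = B g *m B h.
  apply: injW; apply: filterS2 (ae_and (BP (g + h)) (BP h))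
    (ae_and (ae_fiber_shift actS h (BP g)) (fiber_shiftD g h)).
  by move=> z [e1 e2] [e3 e4]; rewrite -e1 e4 e3 e2 mulmxA.
(* The shifted section is again orthonormal, and its Gram matrix is B(h) B(h)^*. *)
have BU h : B h *m (B h)^t* = 1%:M.
  have [z [[e1 e2] e3]] := ae_nonempty (ae_and (ae_and oW (ae_fiber_shift actS h oW)) (BP h)).
  rewrite -e2 e3 trmx_mul map_mxM mulmxA -[_ *m W z *m _]mulmxA e1 mulmx1.
  by [].
(* B(0) is idempotent by the homomorphism law and invertible, hence the identity. *)
have B0 : B 0 = 1%:M.
  have := BD 0 0; rewrite addr0 => /(congr1 (fun M => M *m (B 0)^t*)).
  by rewrite -mulmxA !BU mulmx1.
have BN h : B (- h) = (B h)^t*.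
  by rewrite -[LHS]mulmx1 -(BU h) mulmxA -BD addNr B0 mul1mx.
have [P uP diagP] := unitary_codiagonalization (B := B)
  ltac:(by move=> g h; rewrite -!BD addrC) ltac:(by move=> h; exists (- h)).
have PP : P ^t* *m P = 1%:M.
  by rewrite -(invmx_unitary uP) mulVmx// unitarymx_unit.
exists r, (fun z => P *m W z), (fun h => P *m B h *m P ^t*); split => //.
- exact: relative_section_mull.
- apply: filterS oW => z Wz; rewrite trmx_mul map_mxM mulmxA -[_ *m W z *m _]mulmxA Wz mulmx1.
  exact/unitarymxP.
- move=> k U /spanW[K KP]; exists (K *m P ^t*); apply: filterS KP => z ->.
  by rewrite mulmxA -[_ *m P]mulmxA PP mulmx1.
- move=> h; apply: filterS (BP h) => z ->.
  by rewrite !mulmxA -[_ *m P ^t* *m P]mulmxA PP mulmx1.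
Qed.

(** The row U is a constant combination of the rows of a diagonal section, each entry of which
    splits as a product; the constants are absorbed into the functions of x. *)
Lemma relative_section_decomposition (U : X * Y -> 'rV[R[i]]_n) (i : 'I_n) :
  relative_section U ->
  exists r (q : 'I_r -> X -> R[i]) (F : 'I_r -> Y -> R[i]),
    [/\ forall j, complex_measurable (q j), forall j, eigenfunction nu S (F j) &
        {ae (mu \x nu)%E, forall z, U z 0 i = \sum_j q j z.1 * F j z.2}].
Proof.
move=> sU; have [r [W [D [sW oW spanW diagD shiftW]]]] := diagonal_section.
have [K KP] := spanW _ _ sU.
have H (j : 'I_r) : exists qF : (X -> R[i]) * (Y -> R[i]),
    [/\ complex_measurable qF.1, eigenfunction nu S qF.2 &
        {ae (mu \x nu)%E, forall z, W z j i = qF.1 z.1 * qF.2 z.2}].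
  have [|||q [F [mq eF WqF]]] := @ae_bounded_shift_eigen_decomposition
      (fun z => W z j i) (fun h => D h j j).
  - exact: sW.1.
  - by apply: filterS oW => z; exact: orthonormal_entry_le1.
  - move=> h; apply: filterS (shiftW h) => z ->; rewrite mxE (bigD1 j)//=.
    rewrite big1 ?addr0// => k kj.
    by rewrite (is_diag_mxP (diagD h))// ?mul0r// eq_sym.
  by exists (q, F).
have [qF qFP] := choice H.
exists r, (fun j x => K 0 j * (qF j).1 x), (fun j => (qF j).2); split => [j|j|].
- by apply: complex_measurableM; [exact: complex_measurable_cst|have [] := qFP j].
- by have [] := qFP j.
- have WqF : {ae (mu \x nu)%E, forall z, forall j : 'I_r, W z j i = (qF j).1 z.1 * (qF j).2 z.2}.
    by apply: ae_all => j; have [] := qFP j.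
  apply: filterS2 KP WqF => z -> Wz; rewrite mxE; apply: eq_bigr => j _.
  by rewrite Wz mulrA.
Qed.

End relative_decomposition.

(** * Comparison of the two factors *)

Section factors.
Context {R : realType} {d1 d2 : measure_display} {X : measurableType d1}
  {Y : measurableType d2} {G : topologicalZmodType}.
Variables (mu : probability X R) (nu : probability Y R).
Variables (T : X -> X) (phi : X -> G) (S : G -> Y -> Y).
Hypotheses (mT : measurable_fun setT T) (mphi : measurable_wrt measurable phi).
Hypothesis actS : measurable_action nu S.
Hypothesis ergTphiS : ergodic (mu \x nu)%E (skew_product T phi S).
Hypothesis hG : hausdorff_space G.
Hypothesis lcG : locally_compact [set: G].

Local Notation tau := (skew_product T phi S).
Local Notation base := ([set A `*` [set: Y] | A in (measurable : set (set X))]).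
Local Notation relK := (relative_kronecker_factor (mu \x nu)%E tau base).
Local Notation BK := (product_salgebra (@measurable _ X) (kronecker_factor nu S)).

(** With this, an inclusion modulo null sets has to be checked on generators only. *)
Lemma sigma_algebra_mod_null d (Z : measurableType d) (m : probability Z R)
    (H : set (set Z)) : sigma_algebra setT H ->
  sigma_algebra setT [set A | exists2 B, H B & m.-negligible (A `+` B)].
Proof.
move=> [H0 HC HU]; split.
- by exists set0 => //; rewrite setYK; exact: negligible_set0.
- move=> A [B HB AB]; exists (setT `\` B); first exact: HC.
  apply: negligibleS AB => z; rewrite !setTD => -[[nA /contrapT Bz]|[nB /contrapT Az]].
    by right.
  by left.
- move=> A HA; have /choice[B BP] : forall n, exists B, H B /\ m.-negligible (A n `+` B).
    by move=> n; have [B HB AB] := HA n; exists B.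
  exists (\bigcup_n B n); first by apply: HU => n; exact: (BP n).1.
  have : m.-negligible (\bigcup_n (A n `+` B n)).
    by apply: negligible_bigcup => n; exact: (BP n).2.
  apply: negligibleS => z [[[n _ Az] nB]|[[n _ Bz] nA]]; exists n => //.
    by left; split => // Bz; apply: nB; exists n.
  by right; split => // Az; apply: nA; exists n.
Qed.

Lemma open_neq (w : R[i]^o) : open ([set w' | w' != w] : set R[i]^o).
Proof.
apply/open_complexP => w' /= w'w; exists (Normc.normc (w' - w)) => [|v vw].
  rewrite lt0r normc_ge0 andbT; apply: contra w'w => /eqP/Normc.eq0_normc/eqP.
  by rewrite subr_eq0.
by apply: contraTneq vw => ->; rewrite ltxx.
Qed.

(** The preimage of the open set of values different from f z' is exactly a cylinder over a subset
    of X, and a cylinder cannot separate two points of one fibre. The conclusion thus holds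
    everywhere. *)
Lemma base_measurable_fst (f : X * Y -> R[i]) (z z' : X * Y) :
  measurable_wrt base (f : _ -> R[i]^o) -> z.1 = z'.1 -> f z = f z'.
Proof.
move=> mf zz'; apply/eqP/negPn/negP => fz.
have [A _ AE] := mf _ (@open_neq (f z')).
have : (A `*` [set: Y]) z by rewrite AE.
move=> [Az _]; have : (A `*` [set: Y]) z' by split; rewrite // -zz'.
by rewrite AE /= eqxx.
Qed.

(** X x Y with [BK] as its measurable structure, so that the lemmas on [complex_measurable] apply to
    [BK]. *)
Let BKtype := g_sigma_algebraType
  [set A `*` B | A in @measurable _ X & B in kronecker_factor nu S].

Lemma kronecker_factorT : kronecker_factor nu S setT.
Proof. by rewrite -[setT]setD0; apply: sigma_algebraCD; exact: sigma_algebra0. Qed.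

Lemma product_kronecker_measurable r (q : 'I_r -> X -> R[i]) (F : 'I_r -> Y -> R[i])
    (O : set R[i]^o) :
  (forall j, complex_measurable (q j)) -> (forall j, eigenfunction nu S (F j)) ->
  open O -> BK ((fun z => \sum_j q j z.1 * F j z.2) @^-1` O).
Proof.
move=> mq eF oO.
suff : @complex_measurable R _ BKtype (fun z => \sum_j q j z.1 * F j z.2).
  by move=> /measurable_wrtE; exact.
apply: complex_measurable_sum => j; apply: complex_measurableM.
  apply/measurable_wrtE => V oV; apply: sub_sigma_algebra.
  exists (q j @^-1` V); first by move/measurable_wrtE: (mq j); exact.
  exists setT; first exact: kronecker_factorT.
  by apply/seteqP; split => z // [].
apply/measurable_wrtE => V oV; apply: sub_sigma_algebra.
exists setT; first exact: measurableT.
exists (F j @^-1` V); last by apply/seteqP; split => z // [].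
by apply: sub_sigma_algebra; exists (F j), V; split.
Qed.

(** Cylinders over X already belong to [BK]. An entry of a relative eigenfunction agrees almost
    everywhere with a finite sum of products q_j(x) F_j(y), which is measurable for [BK]. *)
Lemma relative_kronecker_sub A : relK A ->
  exists2 B, BK B & (mu \x nu)%E.-negligible (A `+` B).
Proof.
have sBK : sigma_algebra setT BK by exact: smallest_sigma_algebra.
move: A; apply: smallest_sub; first exact: sigma_algebra_mod_null.
move=> A [[B mB <-]|[n [c [M [i [V [n0 [uc mc mM eM _] oV ->]]]]]]].
  exists (B `*` setT); last by rewrite setYK; exact: negligible_set0.
  apply: sub_sigma_algebra; exists B => //; exists setT => //.
  exact: kronecker_factorT.
have c_fst z z' : z.1 = z'.1 -> c z = c z'.
  by move=> zz'; apply/matrixP => j k; exact: base_measurable_fst (mc j k) zz'.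
have sM : relative_section mu nu T phi S c (fun z => (M z)^T).
  split=> [j k|]; last by apply: filterS eM => z <-; rewrite trmx_mul.
  rewrite (_ : (fun _ => _) = (fun z => M z k ord0)).
    by apply/measurable_wrtE; exact: mM.
  by apply/funext => z; rewrite mxE (ord1 j).
have [r [q [F [mq eF MqF]]]] :=
  relative_section_decomposition mT mphi actS ergTphiS hG lcG uc c_fst i sM.
exists ((fun z => \sum_j q j z.1 * F j z.2) @^-1` V).
  exact: product_kronecker_measurable.
apply: negligibleS MqF => z; rewrite /= mxE => AB e.
by move: AB; rewrite /setY/= e => -[[]|[]].
Qed.

(** It serves the normalization of relative eigenfunctions, where |M|^2 is almost everywhere equal
    to 1. *)
Lemma is_condexp_cst (f : X * Y -> R) (a : R) : measurable_fun setT f ->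
  {ae (mu \x nu)%E, forall z, f z = a} ->
  is_condexp (mu \x nu)%E base f (fun=> a).
Proof.
move=> mf fa.
have ia : (mu \x nu)%E.-integrable setT (EFin \o (fun _ : X * Y => a)).
  by apply: (@bounded_integrable _ _ _ _ _ (fun=> a) `|a|).
split => //.
- apply/integrableP; split; first exact/measurable_EFinP.
  move/integrableP: ia => [_]; congr (_ < _)%E; apply: ae_eq_integral => //.
  + by apply/measurable_EFinP; apply: measurableT_comp.
  + by apply: filterS fa => z /= ->.
- move=> V _; have [Va|nVa] := pselect (V a).
    by exists setT => //; apply/seteqP; split.
  by exists set0 => //; apply/seteqP; split => z // [].
- move=> _ [A mA <-]; have mAY := measurableX mA (@measurableT _ Y).
  apply: ae_eq_integral => //.
  + by apply: measurable_funS measurableT _ _ => //; exact/measurable_EFinP.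
  + by apply: filterS fa => z /= ->.
Qed.

Lemma eigenfunction_relative (f : Y -> R[i]) : eigenfunction nu S f ->
  exists (a : R[i]) (c : X * Y -> 'M[R[i]]_1), a != 0 /\
    relative_eigenfunction (mu \x nu)%E tau base c (fun z => (a * f z.2)%:M).
Proof.
move=> [[/measurable_wrtE mf _] f0 [chi [cchi chiD chi1] eigf]].
have [r r0 fr] := eigenfunction_modulus mT mphi actS ergTphiS mf f0 eigf chi1.
(* |f|^2 is almost everywhere the constant r, so this factor makes the modulus of a f equal to 1. *)
pose a : R[i] := ((Num.sqrt r)^-1)%:C%C.
have aa : a * Num.conj a = (r^-1)%:C%C.
  rewrite mul_conj_normc; congr (_%:C%C).
  by rewrite /= expr0n addr0 sqrtr_sqr normfV ger0_norm ?sqrtr_ge0// exprVn sqr_sqrtr// ltW.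
have mf2 : complex_measurable (fun z : X * Y => a * f z.2).
  apply: complex_measurableM; first exact: complex_measurable_cst.
  by apply: complex_measurable_comp mf _; exact: measurable_snd.
have oneE (b : R[i]) (i j : 'I_1) : (b%:M : 'M[R[i]]_1) i j = b.
  by rewrite (ord1 i) (ord1 j) mxE eqxx mulr1n.
exists a, (fun z => (chi (phi z.1))%:M); split.
  by rewrite eq_complex/= eqxx andbT invr_eq0 sqrtr_eq0 -ltNge.
split.
- move=> z; apply/unitarymxP; rewrite tr_scalar_mx map_scalar_mx -scalar_mxM.
  by rewrite -[X in X%:M]normCK chi1 expr1n.
- move=> i j V oV; exists (phi @^-1` (chi @^-1` V)).
    by apply: mphi; move/continuousP: cchi; exact.
  by apply/seteqP; split => z /=; rewrite oneE => // -[].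
- move=> i; rewrite (_ : (fun _ => _) = (fun z => a * f z.2)).
    exact/measurable_wrtE.
  by apply/funext => z; rewrite oneE.
- have : {ae (mu \x nu)%E, forall z, a * f (tau z).2 = chi (phi z.1) * (a * f z.2)}.
    apply: xsection_ae.
      apply: measurable_complex_eq.
        exact: complex_measurable_comp mf2 (skew_product_measurable actS mT mphi).
      apply: complex_measurableM => //; apply/measurable_wrtE => V oV.
      rewrite (_ : _ @^-1` _ = setT `&` fst @^-1` (phi @^-1` (chi @^-1` V))); last by rewrite setTI.
      by apply: measurable_fst => //; apply: mphi; move/continuousP: cchi; exact.
    apply: aeW => x /=; apply: filterS (eigf (phi x)) => y /= ->.
    by rewrite mulrCA.
  by apply: filterS => z ->; rewrite -scalar_mxM.
- split=> [i j|i]; first by rewrite (ord1 i) (ord1 j) eqxx.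
  have n1 : {ae (mu \x nu)%E, forall z, `|a * f z.2| ^+ 2 = 1}.
    apply: filterS (ae_of_snd mu fr) => z fz.
    rewrite normCK rmorphM mulrACA aa fz -rmorphM/= mulVf ?gt_eqF//.
  have mn : complex_measurable (fun z : X * Y => `|(a * f z.2)%:M i (@ord0 0)| ^+ 2).
    rewrite (_ : (fun _ => _) = (fun z => (a * f z.2) * Num.conj (a * f z.2))).
      by apply: complex_measurableM => //; exact: complex_measurable_conj.
    by apply/funext => z; rewrite oneE normCK.
  split; apply: is_condexp_cst.
  + exact: mn.1.
  + by apply: filterS n1 => z; rewrite oneE => ->.
  + exact: mn.2.
  + by apply: filterS n1 => z; rewrite oneE => ->.
Qed.

(** A rectangle A x B is the intersection of A x Y, which is a generator, and X x B; for the latter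
    it suffices that B is the preimage of an open set under an eigenfunction. The inclusion is
    exact, with no null sets. *)
Lemma product_kronecker_sub : BK `<=` relK.
Proof.
apply: smallest_sub; first exact: smallest_sigma_algebra.
move=> _ [A mA [B KB <-]].
have relT (D : set Y) : kronecker_factor nu S D -> relK (setT `*` D).
  move: D; apply: smallest_sub.
    split => [|D rD|D rD].
    - by rewrite setX0; exact: sigma_algebra0.
    - have -> : [set: X] `*` (setT `\` D) = setT `\` ([set: X] `*` D).
        by apply/seteqP; split => z /= [h1 h2]; split => //; [case: h2 => _ h [_ /h]|
          split => // Dz; apply: h2].
      exact: sigma_algebraCD.
    - by rewrite setX_bigcupr; exact: sigma_algebra_bigcup.
  move=> D [f [V [eF oV ->]]]; have [a [c [a0 relf]]] := eigenfunction_relative eF.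
  apply: sub_sigma_algebra; right.
  (* The open set is rescaled by a to undo the normalization of the eigenfunction. *)
  exists 1%N, c, (fun z => (a * f z.2)%:M), ord0, [set w : R[i]^o | V (a^-1 * w)].
  split => //.
    apply/open_complexP => w /= Vw; have /open_complexP/(_ _ Vw)[e e0 He] := oV.
    have na0 : 0 < Normc.normc a.
      rewrite lt0r normc_ge0 andbT; apply: contra a0.
      by move=> /eqP/Normc.eq0_normc ->.
    exists (Normc.normc a * e) => [|w' ww']; first by rewrite mulr_gt0.
    apply: He; rewrite -mulrBr Normc.normcM Normc.normcV.
    by rewrite mulrC ltr_pdivrMr// mulrC.
  by apply/seteqP; split => z /=; rewrite mxE eqxx mulr1n mulKf// => -[].
rewrite (_ : A `*` B = (A `*` setT) `&` (setT `*` B)); last first.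
  by rewrite -setXI setIT setTI.
apply: (@measurableI _ (g_sigma_algebraType _)); last exact: relT.
by apply: sub_sigma_algebra; left; exists A.
Qed.

End factors.

Theorem proposition8 (R : realType) (d1 d2 : measure_display)
    (X : measurableType d1) (mu : probability X R)
    (Y : measurableType d2) (nu : probability Y R)
    (G : topologicalZmodType)
    (T : X -> X) (phi : X -> G) (S : G -> Y -> Y)
    (stdX : standard_borel R X) (stdY : standard_borel R Y)
    (hausdorffG : hausdorff_space G)
    (secondCountableG : @second_countable G)
    (locallyCompactG : locally_compact [set: G])
    (autT : automorphism mu T)
    (mphi : measurable_wrt measurable phi)
    (actS : measurable_action nu S)
    (ergTphiS : ergodic (mu \x nu)%E (skew_product T phi S)) :
  eq_mod_null (mu \x nu)%E
    (relative_kronecker_factor (mu \x nu)%E (skew_product T phi S)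
       [set A `*` [set: Y] | A in (measurable : set (set X))])
    (product_salgebra measurable (kronecker_factor nu S)).
Proof.
have [mT _ _] := autT.
split=> [A|B BB].
  exact: (relative_kronecker_sub mT mphi actS ergTphiS hausdorffG locallyCompactG).
exists B; last by rewrite setYK; exact: negligible_set0.
exact: (product_kronecker_sub mT mphi actS ergTphiS).
Qed.
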